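(* Let $k$ be a field and $(\mathcal L,\mathcal L_\le)$ a $k$-Stokes structure of exponential type on $S^1$. If the local system $\mathcal L$ is trivial, then $(\mathcal L,\mathcal L_\le)$ is a trivial Stokes structure.
   Context: For $\theta\in S^1$ and $\xi_1,\xi_2\in\mathbb C$, write $\xi_1\le_\theta\xi_2$ if $\operatorname{Re}(\xi_1e^{-i\theta})<\operatorname{Re}(\xi_2e^{-i\theta})$ or $\xi_1=\xi_2$. A $k$-Stokes structure of exponential type $(\mathcal L,\mathcal L_\le)$ with exponents $c_1,\dots,c_n\in\mathbb C$ (distinct) consists of a local system $\mathcal L$ of finite dimensional $k$-vector spaces on $S^1$ and a family of subsheaves $\mathcal L_{\le\xi}\subset\mathcal L$, $\xi\in\mathbb C$, such that: (1) $\xi_1\le_\theta\xi_2$ implies $\mathcal L_{\le\xi_1,\theta}\subset\mathcal L_{\le\xi_2,\theta}$; (2) there exist local systems $\mathrm{gr}_{c_1}\mathcal L,\dots,\mathrm{gr}_{c_n}\mathcal L$ on $S^1$ such that, setting $\mathrm{gr}\mathcal L=\bigoplus_i\mathrm{gr}_{c_i}\mathcal L$ and $(\mathrm{gr}\mathcal L)_{\le\xi}=\bigoplus_ij_{i,\xi!}j_{i,\xi}^*\mathrm{gr}_{c_i}\mathcal L$ with $j_{i,\xi}:\{\theta:c_i\le_\theta\xi\}\hookrightarrow S^1$, there is locally on $S^1$ an isomorphism $\mathcal L\simeq\mathrm{gr}\mathcal L$ carrying $\mathcal L_{\le\xi}$ onto $(\mathrm{gr}\mathcal L)_{\le\xi}$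 for all $\xi$. A local system is trivial if it is constant. The Stokes structure is trivial if the isomorphism $(\mathcal L,\mathcal L_\le)\simeq(\mathrm{gr}\mathcal L,(\mathrm{gr}\mathcal L)_\le)$ exists globally on $S^1$ with all $\mathrm{gr}_{c_i}\mathcal L$ constant. *)

(* Defs.v *)
From HB Require Import structures.
From mathcomp Require Import all_boot all_order all_algebra.
From mathcomp Require Import all_classical all_reals.
From mathcomp Require Import topology normedtype.
From mathcomp Require Import complex.

Set Implicit Arguments.
Unset Strict Implicit.
Unset Printing Implicit Defensive.

Import Order.TTheory GRing.Theory Num.Theory.
Import numFieldNormedType.Exports.
Local Open Scope classical_set_scope.
Local Open Scope ring_scope.
Local Open Scope complex_scope.

Record opens (X : topologicalType) := Opens {
  oset :> set X;
  osetP : open oset }.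

Definition opensT (X : topologicalType) : opens X := Opens (@openT X).

Definition opensI (X : topologicalType) (U V : opens X) : opens X :=
  Opens (openI (osetP U) (osetP V)).

Record sheaf (k : fieldType) (X : topologicalType) := Sheaf {
  sections :> opens X -> lmodType k;
  res : forall U V : opens X, V `<=` U -> {linear sections U -> sections V};
  res_id : forall (U : opens X) (UU : U `<=` U) (s : sections U), res UU s = s;
  res_comp : forall (U V W : opens X) (VU : V `<=` U) (WV : W `<=` V)
      (WU : W `<=` U) (s : sections U),
    res WV (res VU s) = res WU s;
  locality : forall (U : opens X) (I : Type) (W : I -> opens X)
      (WU : forall i, W i `<=` U) (s t : sections U),
    U `<=` \bigcup_i W i ->
    (forall i, res (WU i) s = res (WU i) t) -> s = t;
  gluing : forall (U : opens X) (I : Type) (W : I -> opens X)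
      (WU : forall i, W i `<=` U) (s : forall i, sections (W i)),
    U `<=` \bigcup_i W i ->
    (forall i j, res (@subIsetl _ (W i) (W j) : opensI (W i) (W j) `<=` W i) (s i)
               = res (@subIsetr _ (W i) (W j) : opensI (W i) (W j) `<=` W j) (s j)) ->
    exists t : sections U, forall i, res (WU i) t = s i }.

Arguments res {k X} s {U V} VU : rename.
Arguments res_id {k X} s {U} UU : rename.
Arguments res_comp {k X} s {U V W} VU WV WU : rename.

Section Germs.
Variables (k : fieldType) (X : topologicalType) (F : sheaf k X).

(* The germ of s at x is the equivalence class of pairs (V, t) such that s and
   t agree on a neighbourhood of x; it is meaningful when x belongs to U. *)
Definition germ (x : X) (U : opens X) (s : F U) : set {V : opens X & F V} :=
  [set t : {V : opens X & F V} |
    exists (W : opens X) (WU : W `<=` U) (WV : W `<=` tag t),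
      oset W x /\ res F WU s = res F WV (tagged t)].

Definition supp (U : opens X) (s : F U) : set X :=
  [set x | oset U x /\ germ x s <> germ x (0 : F U)].

Lemma eq_germP (x : X) (U V : opens X) (s : F U) (t : F V) : oset U x ->
  germ x s = germ x t <->
  exists (W : opens X) (WU : W `<=` U) (WV : W `<=` V),
    oset W x /\ res F WU s = res F WV t.
Proof.
move=> Ux; split.
  move=> st.
  have : germ x s (existT (fun V : opens X => F V) U s) by exists U, (@subset_refl _ U), (@subset_refl _ U).
  rewrite st => -[W [WV [WU [Wx e]]]].
  by exists W, WU, WV.
have incl (A B : opens X) (a : F A) (b : F B) :
    (exists (W : opens X) (WU : W `<=` A) (WV : W `<=` B),
      oset W x /\ res F WU a = res F WV b) -> germ x a `<=` germ x b.
  move=> [W [WA [WB [Wx e]]]] [C c] [D [DA [DC [Dx /= e']]]].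
  pose E := opensI W D.
  have EW : E `<=` W by exact: subIsetl.
  have ED : E `<=` D by exact: subIsetr.
  exists E, (subset_trans EW WB), (subset_trans ED DC); split => //=.
  rewrite -(res_comp F WB EW) -e (res_comp F WA EW (subset_trans EW WA)).
  rewrite -(res_comp F DC ED) -e' (res_comp F DA ED (subset_trans EW WA)) //.
move=> [W [WU [WV [Wx e]]]]; apply/seteqP; split; apply: incl.
  by exists W, WU, WV.
by exists W, WV, WU.
Qed.

Lemma germ0P (x : X) (U : opens X) (s : F U) : oset U x ->
  germ x s = germ x (0 : F U) <->
  exists (W : opens X) (WU : W `<=` U), oset W x /\ res F WU s = 0.
Proof.
move=> Ux; rewrite eq_germP//; split.
  by move=> [W [WU [WU' [Wx e]]]]; exists W, WU; rewrite e linear0.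
by move=> [W [WU [Wx e]]]; exists W, WU, WU; rewrite linear0.
Qed.

End Germs.

Record subsheaf (k : fieldType) (X : topologicalType) (F : sheaf k X) := Subsheaf {
  subsections :> forall U : opens X, set (F U);
  subsec0 : forall U : opens X, @subsections U 0;
  subsecP : forall (U : opens X) (a : k) (s t : F U),
    @subsections U s -> @subsections U t -> @subsections U (a *: s + t);
  subsec_res : forall (U V : opens X) (VU : V `<=` U) (s : F U),
    @subsections U s -> @subsections V (res F VU s);
  subsec_local : forall (U : opens X) (I : Type) (W : I -> opens X)
      (WU : forall i, W i `<=` U) (s : F U),
    U `<=` \bigcup_i W i ->
    (forall i, @subsections (W i) (res F (WU i) s)) -> @subsections U s }.

Arguments subsections {k X F} A U : rename.

Definition stalk (k : fieldType) (X : topologicalType) (F : sheaf k X)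
    (A : subsheaf F) (x : X) : set (set {V : opens X & F V}) :=
  [set g | exists (U : opens X) (s : F U), [/\ oset U x, A U s & g = germ x s]].

(* Isomorphisms between the restrictions of F and G to U. *)
Record sheaf_iso (k : fieldType) (X : topologicalType) (U : opens X)
    (F G : sheaf k X) := SheafIso {
  iso_map :> forall V : opens X, V `<=` U -> {linear F V -> G V};
  iso_nat : forall (V W : opens X) (VU : V `<=` U) (WU : W `<=` U)
      (WV : W `<=` V) (s : F V),
    iso_map WU (res F WV s) = res G WV (iso_map VU s);
  iso_bij : forall (V : opens X) (VU : V `<=` U), bijective (iso_map VU) }.

Definition carries (k : fieldType) (X : topologicalType) (U : opens X)
    (F G : sheaf k X) (phi : sheaf_iso U F G) (A : subsheaf F) (B : subsheaf G) :=
  forall (V : opens X) (VU : V `<=` U), phi V VU @` A V = B V.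

(* For j : Z -> X an open inclusion, j_! j^* F is identified through the
   canonical monomorphism j_! j^* F -> F with the subsheaf of F of the sections
   whose support is contained in Z. *)
Section ExtensionByZero.
Variables (k : fieldType) (X : topologicalType) (F : sheaf k X) (Z : opens X).

Let j_sec (U : opens X) : set (F U) := [set s | supp s `<=` Z].

Lemma j_secP (U : opens X) (s : F U) : j_sec s <->
  forall x, oset U x -> ~ oset Z x ->
    exists (W : opens X) (WU : W `<=` U), oset W x /\ res F WU s = 0.
Proof.
split=> [sZ x Ux nZx|h x [Ux]].
  by apply/germ0P => //; apply: contrapT => h; exact/nZx/sZ.
by move=> nsx; apply: contrapT => nZx; apply: nsx; apply/germ0P => //; exact: h.
Qed.

Let j_sec0 U : j_sec (0 : F U).
Proof.
by apply/j_secP => x Ux _; exists U, (@subset_refl _ U); rewrite linear0.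
Qed.

Let j_secL U a (s t : F U) : j_sec s -> j_sec t -> j_sec (a *: s + t).
Proof.
move=> /j_secP hs /j_secP ht; apply/j_secP => x Ux nZx.
have [W [WU [Wx sW]]] := hs x Ux nZx; have [W' [WU' [Wx' tW]]] := ht x Ux nZx.
have EW : opensI W W' `<=` W by exact: subIsetl.
have EW' : opensI W W' `<=` W' by exact: subIsetr.
exists (opensI W W'), (subset_trans EW WU); split => //.
rewrite linearP -{1}(res_comp F WU EW) sW linear0 scaler0 add0r.
by rewrite -(res_comp F WU' EW') tW linear0.
Qed.

Let j_sec_res (U V : opens X) (VU : V `<=` U) (s : F U) :
  j_sec s -> j_sec (res F VU s).
Proof.
move=> /j_secP hs; apply/j_secP => x Vx nZx.
have [W [WU [Wx sW]]] := hs x (VU _ Vx) nZx.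
have EW : opensI W V `<=` W by exact: subIsetl.
have EV : opensI W V `<=` V by exact: subIsetr.
exists (opensI W V), EV; split => //.
by rewrite (res_comp F VU EV (subset_trans EW WU)) -(res_comp F WU EW) sW linear0.
Qed.

Let j_sec_local (U : opens X) (I : Type) (W : I -> opens X)
    (WU : forall i, W i `<=` U) (s : F U) :
  U `<=` \bigcup_i W i -> (forall i, j_sec (res F (WU i) s)) -> j_sec s.
Proof.
move=> cov h; apply/j_secP => x Ux nZx.
have [i _ Wix] := cov x Ux.
have /j_secP/(_ x Wix nZx) [W' [WW [Wx e]]] := h i.
exists W', (subset_trans WW (WU i)); split => //.
by rewrite -(res_comp F (WU i) WW).
Qed.

Definition ext_by_zero : subsheaf F :=
  Subsheaf j_sec0 j_secL j_sec_res j_sec_local.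

End ExtensionByZero.

Section DependentProduct.
Variables (k : fieldType) (I : finType) (V : I -> lmodType k).

Definition dprod : Type := forall i, V i.

HB.instance Definition _ := gen_eqMixin dprod.
HB.instance Definition _ := gen_choiceMixin dprod.

Let zero : dprod := fun i => 0.
Let add (f g : dprod) : dprod := fun i => f i + g i.
Let opp (f : dprod) : dprod := fun i => - f i.
Let scale (a : k) (f : dprod) : dprod := fun i => a *: f i.

Let dprod_ext (f g : dprod) : (forall i, f i = g i) -> f = g.
Proof. exact: functional_extensionality_dep. Qed.

Let addA : associative add.
Proof. by move=> f g h; apply: dprod_ext => i; exact: addrA. Qed.
Let addC : commutative add.
Proof. by move=> f g; apply: dprod_ext => i; exact: addrC. Qed.
Let add0 : left_id zero add.
Proof. by move=> f; apply: dprod_ext => i; exact: add0r. Qed.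
Let addN : left_inverse zero opp add.
Proof. by move=> f; apply: dprod_ext => i; exact: addNr. Qed.

HB.instance Definition _ := GRing.isZmodule.Build dprod addA addC add0 addN.

Let scaleA a b f : scale a (scale b f) = scale (a * b) f.
Proof. by apply: dprod_ext => i; exact: scalerA. Qed.
Let scale1 : left_id 1 scale.
Proof. by move=> f; apply: dprod_ext => i; exact: scale1r. Qed.
Let scaleDr : right_distributive scale +%R.
Proof. by move=> a f g; apply: dprod_ext => i; exact: scalerDr. Qed.
Let scaleDl f : {morph scale^~ f : a b / a + b}.
Proof. by move=> a b; apply: dprod_ext => i; exact: scalerDl. Qed.

HB.instance Definition _ :=
  GRing.Zmodule_isLmodule.Build k dprod scaleA scale1 scaleDr scaleDl.

End DependentProduct.

(* The index set is finite, so the direct sum is the product. *)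
Section DirectSum.
Variables (k : fieldType) (X : topologicalType) (I : finType).
Variable F : I -> sheaf k X.

Let sec (U : opens X) : lmodType k := dprod (fun i => F i U).

Let rsec (U V : opens X) (VU : V `<=` U) (s : sec U) : sec V :=
  fun i => res (F i) VU (s i).

Let rsec_linear (U V : opens X) (VU : V `<=` U) : linear (rsec VU).
Proof.
by move=> a s t; apply: functional_extensionality_dep => i; exact: linearP.
Qed.

HB.instance Definition _ (U V : opens X) (VU : V `<=` U) :=
  GRing.isLinear.Build k (sec U) (sec V) _ (rsec VU) (rsec_linear VU).

Let rs (U V : opens X) (VU : V `<=` U) : {linear sec U -> sec V} := rsec VU.

Let rs_id (U : opens X) (UU : U `<=` U) (s : sec U) : rs UU s = s.
Proof. by apply: functional_extensionality_dep => i; exact: res_id. Qed.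

Let rs_comp (U V W : opens X) (VU : V `<=` U) (WV : W `<=` V)
  (WU : W `<=` U) (s : sec U) : rs WV (rs VU s) = rs WU s.
Proof. by apply: functional_extensionality_dep => i; exact: res_comp. Qed.

Let rs_loc (U : opens X) (J : Type) (W : J -> opens X)
    (WU : forall j, W j `<=` U) (s t : sec U) :
  U `<=` \bigcup_j W j -> (forall j, rs (WU j) s = rs (WU j) t) -> s = t.
Proof.
move=> cov h; apply: functional_extensionality_dep => i.
apply: (locality cov) => j; exact: (congr1 (fun f => f i) (h j)).
Qed.

Let rs_glue (U : opens X) (J : Type) (W : J -> opens X)
    (WU : forall j, W j `<=` U) (s : forall j, sec (W j)) :
  U `<=` \bigcup_j W j ->
  (forall i j, rs (@subIsetl _ (W i) (W j) : opensI (W i) (W j) `<=` W i) (s i)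
             = rs (@subIsetr _ (W i) (W j) : opensI (W i) (W j) `<=` W j) (s j)) ->
  exists t : sec U, forall j, rs (WU j) t = s j.
Proof.
move=> cov h.
have glue : forall i, exists t : F i U, forall j, res (F i) (WU j) t = s j i.
  move=> i; apply: (@gluing _ _ (F i) U J W WU (fun j => s j i)) => // j l.
  exact: (congr1 (fun f => f i) (h j l)).
exists (fun i => sval (cid (glue i))) => j.
apply: functional_extensionality_dep => i; exact: (svalP (cid (glue i))).
Qed.

Definition dsum : sheaf k X := Sheaf rs_id rs_comp rs_loc rs_glue.

Variable A : forall i, subsheaf (F i).

Let asec (U : opens X) : set (dsum U) := [set s : dprod _ | forall i, A i U (s i)].

Let asec0 U : asec (0 : dsum U).
Proof. by move=> i; exact: subsec0. Qed.
Let asecL U a (s t : dsum U) : asec s -> asec t -> asec (a *: s + t).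
Proof. by move=> hs ht i; apply: subsecP; [exact: hs|exact: ht]. Qed.
Let asec_res (U V : opens X) (VU : V `<=` U) (s : dsum U) :
  asec s -> asec (res dsum VU s).
Proof. by move=> h i; apply: subsec_res; exact: h. Qed.
Let asec_local (U : opens X) (J : Type) (W : J -> opens X)
    (WU : forall j, W j `<=` U) (s : dsum U) :
  U `<=` \bigcup_j W j -> (forall j, asec (res dsum (WU j) s)) -> asec s.
Proof.
by move=> cov h i; apply: (subsec_local (WU := WU)) => // j; exact: h.
Qed.

Definition dsum_sub : subsheaf dsum := Subsheaf asec0 asecL asec_res asec_local.

End DirectSum.

Section LocallyConstant.
Variables (k : fieldType) (X : topologicalType) (U : opens X) (V : lmodType k).

Definition loc_const (f : set_type U -> V) : Prop :=
  forall x : set_type U, \forall y \near x, f y = f x.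

Record lcfun := LCFun {
  lc_val :> set_type U -> V;
  lc_valP : lc_val \in [pred f | `[< loc_const f >] ] }.

HB.instance Definition _ := [isSub for lc_val].
HB.instance Definition _ := [Choice of lcfun by <:].

Let lcP (f : set_type U -> V) :
  f \in [pred f | `[< loc_const f >] ] <-> loc_const f.
Proof. by split => [/asboolP|h]; [|exact/asboolP]. Qed.

Let lc_submod : subsemimod_closed [pred f : set_type U -> V | `[< loc_const f >] ].
Proof.
split; first split.
- by apply/lcP => x; near=> y.
- move=> f g /lcP hf /lcP hg; apply/lcP => x.
  near=> y; change (f y + g y = f x + g x); congr (_ + _).
    by near: y; exact: hf.
  by near: y; exact: hg.
- move=> a f /lcP hf; apply/lcP => x.
  near=> y; change (a *: f y = a *: f x); congr (_ *: _).
  by near: y; exact: hf.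
Unshelve. all: by end_near. Qed.

HB.instance Definition _ :=
  GRing.SubChoice_isSubLmodule.Build k _ _ lcfun lc_submod.

End LocallyConstant.

Definition set_pt (X : Type) (A : set X) (x : X) (Ax : A x) : set_type A :=
  SigSub (mem_set Ax).

Definition incl (X : Type) (A B : set X) (BA : B `<=` A) (x : set_type B) :
  set_type A := set_pt (BA _ (set_valP x)).

Lemma near_set_type (X : topologicalType) (U : set X) (x : set_type U)
    (P : set_type U -> Prop) :
  (\forall y \near x, P y) <->
  (\forall z \near set_val x, forall Uz : U z, P (set_pt Uz)).
Proof.
split.
  move=> h; have : nbhs x P by [].
  rewrite nbhsE => -[B [[C oC CB] Bx] BP].
  suff : nbhs (set_val x) [set z | forall Uz : U z, P (set_pt Uz)] by [].
  rewrite nbhsE; exists C.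
    by split => //; move: Bx; rewrite -CB.
  by move=> z Cz Uz; apply: BP; rewrite -CB.
move=> h.
have : nbhs x ((@set_val _ U) @^-1` [set z | forall Uz : U z, P (set_pt Uz)]).
  exact: (@initial_continuous _ _ (@set_val _ U) x _ h).
apply: (@filterS _ (nbhs x)) => y /(_ (set_valP y)).
by have -> : set_pt (set_valP y) = y by exact: val_inj.
Qed.

Section ConstantSheaf.
Variables (k : fieldType) (X : topologicalType) (V : lmodType k).

Let sec (U : opens X) : lmodType k := lcfun U V.

Let lcE (U : opens X) (f : sec U) : loc_const f.
Proof. by have /asboolP := lc_valP f. Qed.

Let sec_ext (U : opens X) (f g : sec U) :
  (forall x : set_type U, f x = g x) -> f = g.
Proof. by move=> fg; apply: val_inj; apply/funext. Qed.

Let lc_incl (A B : opens X) (BA : B `<=` A) (f : sec A) :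
  (f \o incl BA : set_type B -> V) \in [pred f | `[< loc_const f >] ].
Proof.
apply/asboolP => x /=; apply/near_set_type.
have /near_set_type := lcE f (incl BA x); rewrite /=.
by apply: filterS => z h Bz; rewrite -(h (BA _ Bz)); congr (f _); exact: val_inj.
Qed.

Let rsec (A B : opens X) (BA : B `<=` A) (f : sec A) : sec B :=
  LCFun (lc_incl BA f).

Let rsec_linear (A B : opens X) (BA : B `<=` A) : linear (rsec BA).
Proof. by move=> a f g; apply: sec_ext => x. Qed.

HB.instance Definition _ (A B : opens X) (BA : B `<=` A) :=
  GRing.isLinear.Build k (sec A) (sec B) _ (rsec BA) (rsec_linear BA).

Let rs (A B : opens X) (BA : B `<=` A) : {linear sec A -> sec B} := rsec BA.

Let rs_id (A : opens X) (AA : A `<=` A) (s : sec A) : rs AA s = s.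
Proof. by apply: sec_ext => x; congr (s _); exact: val_inj. Qed.

Let rs_comp (A B C : opens X) (BA : B `<=` A) (CB : C `<=` B)
  (CA : C `<=` A) (s : sec A) : rs CB (rs BA s) = rs CA s.
Proof. by apply: sec_ext => x; congr (s _); exact: val_inj. Qed.

Let rs_loc (U : opens X) (J : Type) (W : J -> opens X)
    (WU : forall j, W j `<=` U) (s t : sec U) :
  U `<=` \bigcup_j W j -> (forall j, rs (WU j) s = rs (WU j) t) -> s = t.
Proof.
move=> cov h; apply: sec_ext => x.
have [j _ Wx] := cov _ (set_valP x).
have e : incl (WU j) (set_pt Wx) = x by exact: val_inj.
have := congr1 (fun f : sec (W j) => f (set_pt Wx)) (h j).
by rewrite /= e.
Qed.

Let rs_glue (U : opens X) (J : Type) (W : J -> opens X)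
    (WU : forall j, W j `<=` U) (s : forall j, sec (W j)) :
  U `<=` \bigcup_j W j ->
  (forall i j, rs (@subIsetl _ (W i) (W j) : opensI (W i) (W j) `<=` W i) (s i)
             = rs (@subIsetr _ (W i) (W j) : opensI (W i) (W j) `<=` W j) (s j)) ->
  exists t : sec U, forall j, rs (WU j) t = s j.
Proof.
move=> cov h.
have eqs i j x (Wi : oset (W i) x) (Wj : oset (W j) x) :
    s i (set_pt Wi) = s j (set_pt Wj).
  have Wij : opensI (W i) (W j) `<=` opensI (W i) (W j) by [].
  have := congr1 (fun f : sec (opensI (W i) (W j)) =>
    f (@set_pt _ (opensI (W i) (W j)) x (conj Wi Wj))) (h i j).
  rewrite /= => e.
  transitivity (s i (incl (@subIsetl _ (W i) (W j))
    (@set_pt _ (opensI (W i) (W j)) x (conj Wi Wj)))).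
    by congr (s i _); exact: val_inj.
  by rewrite e; congr (s j _); exact: val_inj.
have ex (x : set_type U) : exists j, oset (W j) (set_val x).
  by have [j _ ?] := cov _ (set_valP x); exists j.
pose t (x : set_type U) : V :=
  s (sval (cid (ex x))) (@set_pt X (W _) (set_val x) (svalP (cid (ex x)))).
have tE (x : set_type U) j (Wx : oset (W j) (set_val x)) : t x = s j (set_pt Wx).
  exact: eqs.
have lt : t \in [pred f | `[< loc_const f >] ].
  apply/asboolP => x; apply/near_set_type.
  have [j Wx] := ex x.
  have /near_set_type/= := lcE (s j) (set_pt Wx).
  have : nbhs (set_val x) (W j : set X).
    by apply: open_nbhs_nbhs; split => //; exact: osetP.
  move=> A B; apply: filterS (filterI A B) => z [Wz Bz] Uz.
  rewrite (tE _ _ (Wz : oset (W j) (set_val (set_pt Uz)))) (tE _ _ Wx).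
  exact: Bz.
exists (LCFun lt) => j; apply: sec_ext => x /=.
rewrite (tE _ j (set_valP x : oset (W j) (set_val (incl (WU j) x)))); congr (s j _); exact: val_inj.
Qed.

Definition const_sheaf : sheaf k X := Sheaf rs_id rs_comp rs_loc rs_glue.

End ConstantSheaf.

Definition local_system (k : fieldType) (X : topologicalType) (F : sheaf k X) :=
  forall x : X, exists U : opens X, oset U x /\
    exists V : vectType k, inhabited (sheaf_iso U F (const_sheaf X V)).

Definition constant_local_system (k : fieldType) (X : topologicalType)
    (F : sheaf k X) :=
  exists V : vectType k, inhabited (sheaf_iso (opensT X) F (const_sheaf X V)).

(* R[i] gets its topology from its structure of numFieldType. *)
Definition cplx (R : realType) : numFieldType := R[i].

(* The point theta is represented by the complex number e^{i theta}, so that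
   e^{- i theta} is its conjugate. *)
Definition circle (R : realType) : topologicalType :=
  set_type [set z : cplx R | `|z| = 1].

Definition expNi (R : realType) (theta : circle R) : R[i] :=
  ((set_val theta : R[i])^*)%C.

Definition le_theta (R : realType) (theta : circle R) (xi1 xi2 : R[i]) : Prop :=
  complex.Re (xi1 * expNi theta) < complex.Re (xi2 * expNi theta) \/ xi1 = xi2.

Lemma open_Re_gt0 (R : realType) (a : R[i]) :
  open [set z : cplx R | 0 < complex.Re (a * (z : R[i])^*%C)].
Proof.
rewrite openE => z /= z0; rewrite /interior -nbhs_ballE.
set r := complex.Re _ in z0.
have a1 : (0 : R[i]) < `|a| + 1 by rewrite ltr_wpDl.
exists (r%:C / (`|a| + 1)); first by rewrite /= divr_gt0// ltcR.
move=> y; rewrite /ball /= => zy.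
have zy' : `|(z : R[i]) - y| * (`|a| + 1) < r%:C by rewrite -ltr_pdivlMr.
have h : `|a * (((z : R[i]) - y)^*)%C| < r%:C.
  rewrite normrM; have -> : `|(((z : R[i]) - y)^*)%C| = `|(z : R[i]) - y|.
    exact: norm_conjC.
  rewrite mulrC; apply: le_lt_trans zy'; rewrite ler_wpM2l// lerDl//.
have := le_lt_trans (normc_ge_Re _) h; rewrite ltcR => /(le_lt_trans (ler_norm _)).
by rewrite rmorphB mulrBr raddfB /= -/r ltrBlDl -ltrBlDr subrr.
Qed.

Lemma open_le_theta (R : realType) (c xi : R[i]) :
  open [set theta : circle R | le_theta theta c xi].
Proof.
have [<-|/eqP cx] := eqVneq c xi.
  suff -> : [set theta : circle R | le_theta theta c c] = setT by exact: openT.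
  by apply/seteqP; split => // theta _; right.
exists [set z : cplx R | 0 < complex.Re ((xi - c) * (z : R[i])^*%C)].
  exact: open_Re_gt0.
apply/seteqP; split => theta /=; rewrite mulrBl raddfB subr_gt0; first by left.
by case.
Qed.

Section Stokes.
Variables (k : fieldType) (R : realType) (n : nat) (c : 'I_n -> R[i]).

Definition stokes_open (i : 'I_n) (xi : R[i]) : opens (circle R) :=
  Opens (open_le_theta (c i) xi).

Definition gr_le (gr : 'I_n -> sheaf k (circle R)) (xi : R[i]) :
    subsheaf (dsum gr) :=
  dsum_sub (fun i => ext_by_zero (gr i) (stokes_open i xi)).

Record stokes_structure := StokesStructure {
  exponents_inj : injective c;
  stokes_sheaf : sheaf k (circle R);
  stokes_local_system : local_system stokes_sheaf;
  stokes_le : R[i] -> subsheaf stokes_sheaf;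
  stokes_le_mono : forall (theta : circle R) (xi1 xi2 : R[i]),
    le_theta theta xi1 xi2 ->
    stalk (stokes_le xi1) theta `<=` stalk (stokes_le xi2) theta;
  stokes_graded : exists gr : 'I_n -> sheaf k (circle R),
    (forall i, local_system (gr i)) /\
    forall theta : circle R, exists U : opens (circle R), oset U theta /\
      exists phi : sheaf_iso U stokes_sheaf (dsum gr),
        forall xi, carries phi (stokes_le xi) (gr_le gr xi) }.

Definition trivial_stokes (S : stokes_structure) :=
  exists gr : 'I_n -> sheaf k (circle R),
    (forall i, constant_local_system (gr i)) /\
    exists phi : sheaf_iso (opensT (circle R)) (stokes_sheaf S) (dsum gr),
      forall xi, carries phi (stokes_le S xi) (gr_le gr xi).

End Stokes.

(* Main.v *)
Require Import Defs.
From HB Require Import structures.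
From mathcomp Require Import all_boot all_order all_algebra.
From mathcomp Require Import all_classical all_reals.
From mathcomp Require Import topology normedtype.
From mathcomp Require Import complex.
From mathcomp Require Import ring lra.

Set Implicit Arguments.
Unset Strict Implicit.
Unset Printing Implicit Defensive.

Import Order.TTheory GRing.Theory Num.Theory.
Import numFieldNormedType.Exports.
Local Open Scope classical_set_scope.
Local Open Scope ring_scope.

(** A trivialisation of L turns the Stokes structure into linear algebra in a
    single space V: at each direction theta, the vectors v whose constant
    section belongs to L_<=xi near theta form a subspace F_theta(xi) of V, and
    L_<=xi can be recovered from these subspaces ([subsections_germ]).  Near
    each direction the grading gives a decomposition of V, indexed by the
    exponents, such that F_theta(xi) is the sum of the pieces whose exponent is
    <=_theta xi ([germ_const_graded]).  The theorem amounts to finding one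
    decomposition that does this for all theta at once ([circle_splitting]);
    constant sheaves on its pieces are then the graded sheaves sought
    ([gr_iso_carries]).

    The decomposition is found as follows.  Choose a direction theta_0 at which
    the real parts of the c_i e^{-i theta_0} are distinct.  At theta_0 and at
    theta_0 + pi the orders on the exponents are total and opposite to each other,
    so the F_{theta_0}(c_i) and the F_{theta_0 + pi}(c_i) are two flags, with
    graded pieces of the same dimensions.  On each of the two half circles from theta_0 to
    theta_0 + pi, a pair of exponents is exchanged exactly once.  This makes it
    possible to transport vectors: by a continuous induction along the half
    circle, each class in the i-th graded piece at the current direction is the
    class of a vector that lies in F_theta(c_i) for all the directions theta
    swept so far ([sweep_lift]).  At a direction where c_j and c_i tie, a vector
    may leave F(c_i) through its j-th component; but then c_j was below c_i all
    the way from theta_0, so that subtracting a lift of this component changes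
    neither the class of the vector nor the fact that it lies in F(c_i).

    At the end of the half circle, the spaces Y_i of vectors lying in
    F_theta(c_i) for all swept theta span V.  A count of dimensions then shows
    that the two flags are transversal ([transversal]), hence that V is the
    direct sum of the Y_i and that Y_i is the intersection of F_{theta_0}(c_i)
    and F_{theta_0 + pi}(c_i) ([span_ends]).  This intersection is the same for both
    half circles, precisely because L has no monodromy.  So Y_i lies in
    F_theta(c_i) for all theta in the circle, and comparing dimensions shows
    that the Y_i split every F_theta(xi) ([decomposition_supported]). *)

(** * Decompositions of a vector space and filtrations *)

Section Decompositions.
Variables (k : fieldType) (V : vectType k) (I : finType).
Implicit Types (e f : I -> 'End(V)) (D : pred I) (v w : V).

(** A direct sum decomposition is given by its projections, so that it makes
    sense without reference to the sheaves from which it comes. *)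
Definition decomposition e :=
  (forall i j v, e i (e j v) = if i == j then e j v else 0) /\
  (forall v, \sum_i e i v = v).

Definition supported e D v := forall j, ~~ D j -> e j v = 0.

Definition suppv e D : {vspace V} := (\sum_(j | D j) limg (e j))%VS.

Lemma decomp_id e i v : decomposition e -> e i (e i v) = e i v.
Proof. by case=> h _; rewrite h eqxx. Qed.

Lemma decomp_neq e i j v : decomposition e -> i != j -> e i (e j v) = 0.
Proof. by case=> h _ /negbTE ij; rewrite h ij. Qed.

Lemma supported_img e D i v : decomposition e -> D i -> supported e D (e i v).
Proof.
by move=> de Di j nDj; apply: decomp_neq => //; apply: contraNneq nDj => ->.
Qed.

Lemma supported_eq_sum e D v : decomposition e -> supported e D v ->
  v = \sum_(j | D j) e j v.
Proof.
move=> [_ s] h; rewrite -{1}(s v) (bigID D) /= [X in _ + X]big1 ?addr0 //.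
Qed.

Lemma supportedS e D D' v : (forall j, D j -> D' j) ->
  supported e D v -> supported e D' v.
Proof. by move=> DD h j nD; apply: h; apply: contra nD; exact: DD. Qed.

Lemma supported0 e D : supported e D 0.
Proof. by move=> j _; rewrite linear0. Qed.

Lemma supportedD e D v w :
  supported e D v -> supported e D w -> supported e D (v + w).
Proof. by move=> hv hw j nD; rewrite linearD /= hv // hw // addr0. Qed.

Lemma supportedN e D v : supported e D v -> supported e D (- v).
Proof. by move=> hv j nD; rewrite linearN /= hv // oppr0. Qed.

Lemma supported_sum e D (J : finType) (P : pred J) (x : J -> V) :
  (forall j, P j -> supported e D (x j)) ->
  supported e D (\sum_(j | P j) x j).
Proof.
move=> h; elim/big_ind: _ => //; [exact: supported0|exact: supportedD].
Qed.

Lemma memv_suppv e D v : decomposition e ->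
  reflect (supported e D v) (v \in suppv e D).
Proof.
move=> de; apply: (iffP idP).
  move=> /memv_sumP[x xe ->]; apply: supported_sum => j Dj.
  by have /memv_imgP[u _ ->] := xe j Dj; exact: supported_img.
move=> /(supported_eq_sum de) ->; apply: memv_sumr => j Dj.
by apply: memv_img; exact: memvf.
Qed.

Lemma dim_suppv e D : decomposition e ->
  \dim (suppv e D) = (\sum_(j | D j) \dim (limg (e j)))%N.
Proof.
move=> de; apply/directvP/directv_sum_independent => x xe x0 i Di.
have ex j : D j -> e j (x j) = x j.
  by move=> /xe/memv_imgP[u _ ->]; exact: decomp_id.
rewrite -(ex i Di) -[RHS](linear0 (e i)) -x0 linear_sum (bigD1 i) //=.
rewrite [X in _ + X]big1 ?addr0// => j /andP[Dj ji].
by rewrite -(ex j Dj) decomp_neq // eq_sym.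
Qed.

Lemma dim_decomposition e : decomposition e ->
  (\sum_j \dim (limg (e j)))%N = \dim (@fullv _ V).
Proof.
move=> de; rewrite -(dim_suppv predT de); congr (\dim _).
by apply/vspaceP => v; rewrite memvf; apply/memv_suppv.
Qed.

Lemma leq_dim_limg (g h : 'End(V)) : (forall v, h (g v) = 0 -> g v = 0) ->
  (\dim (limg g) <= \dim (limg h))%N.
Proof.
move=> hg; rewrite -[X in (X <= _)%N](@limg_ker_dim _ _ _ h).
rewrite (_ : (limg g :&: lker h)%VS = 0%VS) ?dimv0 ?add0n.
  exact/dimvS/limgS/subvf.
apply/eqP; rewrite -subv0; apply/subvP => v /memv_capP[/memv_imgP[u _ ->]].
by rewrite memv_ker memv0 => /eqP/hg ->.
Qed.

End Decompositions.

Lemma finite_real_ind (R : realType) (I : finType) (p : I -> R) (Q : I -> Prop) :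
  (forall i, (forall j, p j < p i -> Q j) -> Q i) -> forall i, Q i.
Proof.
move=> h i; move: {2}(#|_|).+1 (ltnSn #|[pred j | p j < p i]|) => m.
elim: m i => // m IH i cm; apply: h => j ji; apply: IH.
apply: leq_trans (cm : (_ <= m)%N); apply: proper_card; apply/properP; split.
  by apply/fintype.subsetP => l; rewrite !inE => lj; exact: lt_trans lj ji.
by exists j; rewrite !inE ?ltxx.
Qed.

Section PositionOrder.
Variables (k : fieldType) (V : vectType k) (I : finType) (R : realType).

(** This is <=_theta when [p] gives the heights, that is, the real parts of the
    c_i e^{-i theta}: distinct exponents at the same height are incomparable. *)
Definition below (p : I -> R) (i : I) : pred I :=
  fun j => (j == i) || (p j < p i).

Definition adapted (e : I -> 'End(V)) (p : I -> R) (F : I -> V -> Prop) :=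
  forall i v, F i v <-> supported e (below p i) v.

Lemma below_refl p i : below p i i. Proof. by rewrite /below eqxx. Qed.

Lemma below_trans p i j l : below p i j -> below p j l -> below p i l.
Proof.
move=> /orP[/eqP->//|ji] /orP[/eqP->|lj]; apply/orP; right => //.
exact: lt_trans lj ji.
Qed.

Lemma belowN p i j : j != i -> below p i j -> ~~ below p j i.
Proof.
move=> ji; rewrite /below (negbTE ji) eq_sym (negbTE ji) /= => /lt_gtF ->//.
Qed.

(** The i-th graded piece of a filtration does not depend on the decomposition:
    the other components of an element of F i come from lower steps, on which
    the i-th projection vanishes. *)
Lemma change_leading (e f : I -> 'End(V)) p F i x :
  decomposition e -> decomposition f -> adapted e p F -> adapted f p F ->
  F i x -> e i (f i x) = e i x.
Proof.
move=> de df ae af /af xf; have [_ fs] := df.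
rewrite -[in RHS](fs x) linear_sum (bigD1 i) //=.
rewrite [X in _ + X]big1 ?addr0 // => j ji.
have [bji|nb] := boolP (below p i j); last by rewrite xf // linear0.
have /ae : F j (f j x) by apply/af/supported_img => //; exact: below_refl.
by apply; exact: belowN.
Qed.

Lemma adapted_dim (e f : I -> 'End(V)) p F i :
  decomposition e -> decomposition f -> adapted e p F -> adapted f p F ->
  \dim (limg (e i)) = \dim (limg (f i)).
Proof.
have half (g h : I -> 'End(V)) : decomposition g -> decomposition h ->
    adapted g p F -> adapted h p F ->
    (\dim (limg (g i)) <= \dim (limg (h i)))%N.
  move=> dg dh ag ah; apply: leq_dim_limg => v hgv.
  rewrite -(decomp_id i v dg) -(change_leading dg dh ag ah) ?hgv ?linear0 //.
  by apply/ag/supported_img => //; exact: below_refl.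
by move=> de df ae af; apply/eqP; rewrite eqn_leq !half.
Qed.

End PositionOrder.

(** * Sweeping a half circle *)

(** Continuous induction: the supremum b of the t such that P holds up to t is
    reached by the first local hypothesis and passed by the second one. *)
Lemma interval_propagation (R : realType) (P : R -> Prop) :
  P (-1) ->
  (forall b, -1 <= b <= 1 -> exists2 d, 0 < d & forall t, -1 <= t <= 1 ->
     (b - d < t <= b -> P t -> P b) /\ (b <= t < b + d -> P b -> P t)) ->
  forall t, -1 <= t <= 1 -> P t.
Proof.
move=> P0 loc.
pose S := [set t : R | -1 <= t <= 1 /\ forall s, -1 <= s <= t -> P s].
have S0 : S (-1).
  split; first by lra.
  by move=> s s1; have -> : s = -1 by lra.
have supS : has_sup S.
  by split; [exists (-1)|exists 1 => t [/andP[]]].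
pose b := sup S.
have b1 : -1 <= b <= 1.
  apply/andP; split; first exact: sup_upper_bound.
  by apply: ge_sup; [exists (-1)|move=> t [/andP[]]].
have [d d0 prop] := loc b b1.
have [t [t1 tP] bt] := sup_adherent d0 supS; rewrite -/b in bt.
have tb : t <= b by apply: sup_upper_bound => //; split.
have Pb : P b by apply: (prop t t1).1; [lra|apply: tP; lra].
have beyond s : -1 <= s <= 1 -> s < b + d -> P s.
  move=> s1 sbd; have [sb|bs] := ltP s b.
    have bs0 : 0 < b - s by lra.
    have [u [u1 uP]] := sup_adherent bs0 supS; rewrite -/b => su.
    by apply: uP; lra.
  by apply: (prop s s1).2 => //; lra.
have [bd|bd] := leP (b + d) 1; last by move=> s s1; apply: beyond => //; lra.
have : S (b + d / 2).
  by split; [lra|move=> s ?; apply: beyond; lra].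
by move=> /(sup_upper_bound supS); rewrite -/b => ?; exfalso; lra.
Qed.

Section Sweep.
Variables (k : fieldType) (V : vectType k) (I : finType) (R : realType).
Variables (p : R -> I -> R) (F : R -> I -> V -> Prop).

(** [t] in [-1, 1] parametrises a half circle, [p t] gives the heights of the
    exponents at the parameter t and [F t] the steps of the filtration. *)
Definition locally_split := forall b, -1 <= b <= 1 ->
  exists2 d, 0 < d & exists2 e, decomposition e &
    forall t, -1 <= t <= 1 -> b - d < t < b + d ->
      adapted e (p t) (F t) /\ forall i j, p b i < p b j -> p t i < p t j.

(** Along a half circle two exponents tie at most once: if they tie at b, their
    order just before b was already the same at the start. *)
Definition persistent := forall i j b s, -1 <= s -> s < b -> b <= 1 ->
  i != j -> p b j = p b i -> p s j < p s i ->
  forall t, -1 <= t < b -> p t j < p t i.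

Definition throughout (t : R) (i : I) (v : V) :=
  forall s, -1 <= s <= t -> F s i v.

Hypothesis locF : locally_split.
Hypothesis pers : persistent.

Lemma adapted_at (t : R) : -1 <= t <= 1 ->
  exists2 e, decomposition e & adapted e (p t) (F t).
Proof.
move=> t1; have [d d0 [e de ad]] := locF t1.
by exists e => //; apply: (ad t t1 _).1; lra.
Qed.

Lemma position_mono (t : R) i j v : -1 <= t <= 1 -> p t j < p t i ->
  F t j v -> F t i v.
Proof.
move=> t1 ji; have [e _ ae] := adapted_at t1.
move=> /ae Fj; apply/ae; apply: supportedS Fj => l.
by apply: below_trans; rewrite /below ji orbT.
Qed.

(** The dimensions of the graded pieces are locally constant, and two
    decompositions adapted to the same filtration have the same ones. *)
Lemma sweep_dim e f (t : R) i : decomposition e -> decomposition f ->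
  adapted e (p (-1)) (F (-1)) -> -1 <= t <= 1 -> adapted f (p t) (F t) ->
  \dim (limg (f i)) = \dim (limg (e i)).
Proof.
move=> de df ae t1; move: t t1 f df.
pose P t := forall f, decomposition f -> adapted f (p t) (F t) ->
  \dim (limg (f i)) = \dim (limg (e i)).
suff: forall t, -1 <= t <= 1 -> P t by move=> h t /h.
apply: interval_propagation => [f df af|b b1].
  exact: adapted_dim af ae.
have [d d0 [g dg ad]] := locF b1; exists d => // t t1.
have [|gb _] := ad b b1; first by lra.
split=> bt Pt f df af.
  rewrite (adapted_dim i df dg af gb); apply: Pt => //.
  by apply: (ad t t1 _).1; lra.
by rewrite (adapted_dim i df dg af (ad t t1 _).1) ?Pt //; lra.
Qed.

(** Two elements of the i-th step have the same class in the i-th graded piece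
    when e_i takes the same value on them: at t every class extends back to -1. *)
Definition liftable (t : R) (e : I -> 'End(V)) :=
  forall i x, exists2 w, throughout t i w & e i w = e i x.

Lemma liftable_indep (t : R) e f : -1 <= t -> decomposition e -> decomposition f ->
  adapted e (p t) (F t) -> adapted f (p t) (F t) ->
  liftable t e -> liftable t f.
Proof.
move=> t1 de df ae af le i x.
have fx : F t i (f i x) by apply/af/supported_img => //; exact: below_refl.
have [w ww ew] := le i (f i x); exists w => //.
have Fw : F t i w by apply: ww; lra.
rewrite -(change_leading df de af ae Fw) ew (change_leading df de af ae fx).
exact: decomp_id.
Qed.

(** At b some exponents that were below c_i tie with it.  The components of a lift along them are
    removed by subtracting lifts of these components, which are available by
    induction on the height at s, and which already have no component along
    the other exponents tied at b. *)
Lemma liftable_across (b s : R) e : -1 <= s -> s < b -> b <= 1 -> decomposition e ->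
  (forall t, s <= t <= b -> adapted e (p t) (F t)) ->
  (forall t i j, s <= t <= b -> p b i < p b j -> p t i < p t j) ->
  liftable s e -> liftable b e.
Proof.
move=> s1 sb b1 de ad strict ls.
have as_ : adapted e (p s) (F s) by apply: ad; lra.
suff peel i : forall x, exists2 w, throughout s i w & e i w = e i x /\
    forall j, j != i -> p b j = p b i -> e j w = 0.
  (* After s, only the components of w along exponents that tie with the i-th
     one at b could leave the step i. *)
  move=> i x; have [w ww [ew tw]] := peel i x; exists w => // t t1.
  have [ts|st] := leP t s; first by apply: ww; lra.
  apply/(ad t) => [|j]; first lra.
  rewrite negb_or -leNgt => /andP[ji tij].
  have [ji'|ij|] := ltgtP (p b j) (p b i); last exact: tw.
    have : p t j < p t i by apply: strict => //; lra.
    by rewrite ltNge tij.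
  have /as_ : F s i w by apply: ww; lra.
  apply; rewrite negb_or ji -leNgt ltW //; apply: strict => //; lra.
elim/(@finite_real_ind _ _ (p s)): i => i IH x.
have [w ww ew] := ls i x.
(* B is the set of the exponents below c_i at s that tie with it at b: by
   persistence they are below c_i on the whole of [-1, b). *)
pose B j := [&& j != i, p b j == p b i & p s j < p s i].
have /choice[u uP] j : exists u, B j ->
    [/\ throughout s j u, e j u = e j w &
        forall l, l != j -> p b l = p b j -> e l u = 0].
  have [/and3P[_ _ ji]|_] := boolP (B j); last by exists 0.
  by have [u uu [eu tu]] := IH j ji w; exists u.
exists (w - \sum_(j | B j) u j).
  (* Here w and the u j stay in the step i from -1 to s. *)
  move=> t t1; have t1b : -1 <= t <= b by lra.
  have [g dg ag] : exists2 g, decomposition g & adapted g (p t) (F t).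
    by apply: adapted_at; lra.
  apply/ag/supportedD; first by apply/ag/ww.
  apply: supportedN; apply: supported_sum => j Bj; apply/ag.
  have [uj _ _] := uP j Bj; have /and3P[ji /eqP bji sji] := Bj.
  apply: (@position_mono t i j) => //; [lra| |exact: uj].
  by apply: (pers s1 sb b1 _ bji) => //; [rewrite eq_sym|lra].
have eB l j : p b l = p b i -> l != j -> B j -> e l (u j) = 0.
  move=> bl lj Bj; have [_ _] := uP j Bj; apply => //.
  by have /and3P[_ /eqP -> _] := Bj.
split.
  rewrite linearB linear_sum /= big1 ?subr0 // => j Bj.
  by apply: eB => //; rewrite eq_sym; have /and3P[] := Bj.
move=> l li bl; rewrite linearB linear_sum /=.
have [sli|nsli] := boolP (p s l < p s i).
  have Bl : B l by rewrite /B li bl eqxx.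
  rewrite (bigD1 l) //= big1 ?addr0; last first.
    by move=> j /andP[Bj jl]; apply: eB => //; rewrite eq_sym.
  by have [_ -> _] := uP l Bl; rewrite subrr.
rewrite big1 ?subr0.
  have /as_ : F s i w by apply: ww; lra.
  by apply; rewrite negb_or li.
move=> j Bj; apply: eB => //; apply: contraNneq nsli => ->.
by have /and3P[] := Bj.
Qed.

(** Just before b lifts are moved to b by [liftable_across]; just after b they
    remain lifts, since what is below c_i at b is below it nearby. *)
Lemma sweep_lift (t : R) e : -1 <= t <= 1 -> decomposition e ->
  adapted e (p t) (F t) -> liftable t e.
Proof.
move=> t1; move: t t1 e.
pose P t := forall e, decomposition e -> adapted e (p t) (F t) -> liftable t e.
suff: forall t, -1 <= t <= 1 -> P t by move=> h t /h.
apply: interval_propagation => [e de ae i x|b b1].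
  exists (e i x); last exact: decomp_id.
  move=> s s1; have -> : s = -1 by lra.
  by apply/ae/supported_img => //; exact: below_refl.
have [d d0 [g dg ad]] := locF b1; exists d => // t t1.
have [|gb _] := ad b b1; first by lra.
split=> bt Pt e de ae.
  apply: (liftable_indep _ dg de gb ae); first lra.
  have [->|tb] := eqVneq b t.
    by apply: Pt => //; apply: (ad t t1 _).1; lra.
  have {}tb : t < b by rewrite lt_neqAle eq_sym tb; lra.
  apply: (@liftable_across b t) => //; [lra|lra|..].
  - by move=> s st; apply: (ad s _ _).1; lra.
  - by move=> s i j st; apply: (ad s _ _).2; lra.
  - by apply: Pt => //; apply: (ad t t1 _).1; lra.
have at_ : adapted g (p t) (F t) by apply: (ad t t1 _).1; lra.
apply: (liftable_indep _ dg de at_ ae); first lra.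
move=> i x; have [w ww ew] := Pt g dg gb i x; exists w => // s s1.
have [sb|bs] := leP s b; first by apply: ww; lra.
have /gb Fw : F b i w by apply: ww; lra.
have [||as_ st] := ad s; [lra|lra|].
apply/as_; apply: supportedS Fw => j /orP[/eqP->|ji]; first exact: below_refl.
by rewrite /below st ?orbT.
Qed.

End Sweep.

(** * Opposite flags at the ends of a half circle *)

Section OppositeFlags.
Variables (k : fieldType) (V : vectType k) (I : finType) (R : realType).
Variables (p : R -> I -> R) (F : R -> I -> V -> Prop).
Hypothesis locF : locally_split p F.
Hypothesis pers : persistent p.
Hypothesis inj_p : injective (p (-1)).
Hypothesis rev_p : forall i j, (p 1 i < p 1 j) = (p (-1) j < p (-1) i).

Let ge1 : -1 <= (-1 : R) <= 1. Proof. by lra. Qed.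
Let le1 : -1 <= (1 : R) <= 1. Proof. by lra. Qed.

(** By induction on the height at 1, each piece of an adapted decomposition is
    spanned: a lift differs from the element it lifts by lower components. *)
Lemma throughout_span u :
  exists2 y, forall i, throughout F 1 i (y i) & u = \sum_i y i.
Proof.
have [f df af] := adapted_at locF le1.
pose Y v := exists2 y, forall i, throughout F 1 i (y i) & v = \sum_i y i.
have throughoutB i v w :
    throughout F 1 i v -> throughout F 1 i w -> throughout F 1 i (v - w).
  move=> hv hw t t1; have [g dg ag] := adapted_at locF t1.
  by apply/ag/supportedD; [apply/ag/hv|apply/supportedN/ag/hw].
have throughout0 i : throughout F 1 i 0.
  by move=> t t1; have [g dg ag] := adapted_at locF t1; apply/ag/supported0.
have Y0 : Y 0 by exists (fun=> 0) => //; rewrite big1.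
have YB v1 v2 : Y v1 -> Y v2 -> Y (v1 - v2).
  move=> [y1 h1 ->] [y2 h2 ->]; exists (fun i => y1 i - y2 i).
    by move=> i; exact: throughoutB.
  by rewrite sumrB.
have YD v1 v2 : Y v1 -> Y v2 -> Y (v1 + v2).
  by move=> h1 h2; rewrite -[v2]opprK -[- v2]sub0r; apply: (YB _ _ h1); exact: YB.
have Ysum (P : pred I) x : (forall i, P i -> Y (x i)) -> Y (\sum_(i | P i) x i).
  by move=> h; elim/big_ind: _.
suff Yf i x : Y (f i x) by rewrite -(df.2 u); exact: Ysum.
elim/(@finite_real_ind _ _ (p 1)): i x => i IH x.
have [w ww fw] := sweep_lift locF pers le1 df af i x.
have Yw : Y w.
  exists (fun j => if j == i then w else 0).
    by move=> j; case: eqP => [->|_].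
  by rewrite -big_mkcond big_pred1_eq.
have /af/(supported_eq_sum df) ws := ww 1 le1.
have -> : f i x = w - \sum_(j | below (p 1) i j && (j != i)) f j w.
  by rewrite {1}ws (bigD1 i) ?below_refl //= fw addrK.
apply: YB => //; apply: Ysum => j /andP[/orP[->//|ji] _]; exact: IH.
Qed.

(** The step D of the first flag and the complementary step of the second one
    span V together, because the [throughout] vectors do and each of them lies
    in one of the two; as their dimensions add up to that of V, they meet in
    0. *)
Lemma transversal e f (D : pred I) v : decomposition e -> decomposition f ->
  adapted e (p (-1)) (F (-1)) -> adapted f (p 1) (F 1) ->
  (forall i j, D j -> p (-1) i <= p (-1) j -> D i) ->
  supported e D v -> supported f (predC D) v -> v = 0.
Proof.
move=> de df ae af downD ev fv.
(* A vector of Y_j lies in the first space if D j, in the second one if not. *)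
have full : (suppv e D + suppv f (predC D))%VS = fullv.
  apply/vspaceP => u; rewrite memvf.
  have [y yy ->] := throughout_span u; rewrite (bigID D) /= memv_add //.
    apply: memv_suml => j Dj; apply/memv_suppv => //.
    have /ae := yy j (-1) ge1; apply: supportedS => l.
    by move=> /orP[/eqP->//|/ltW lj]; exact: downD lj.
  apply: memv_suml => j nDj; apply/memv_suppv => //.
  have /af := yy j 1 le1; apply: supportedS => l.
  move=> /orP[/eqP->//|]; rewrite rev_p => /ltW jl /=.
  by apply: contra nDj => Dl; exact: downD jl.
have := dimv_sum_cap (suppv e D) (suppv f (predC D)).
have -> : \dim (suppv f (predC D)) = \dim (suppv e (predC D)).
  rewrite !dim_suppv //; apply: eq_bigr => j _.
  exact: (sweep_dim locF j de df ae le1 af).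
rewrite full !dim_suppv // -(dim_decomposition de) (bigID D) /=.
move/eqP; rewrite -[X in _ == X]addn0 eqn_add2l dimv_eq0 => /eqP cap0.
apply/eqP; rewrite -memv0 -cap0 memv_cap.
by apply/andP; split; apply/memv_suppv.
Qed.

(** In v = y_i + A + B, with A and B the sums of the y_j for j before and
    after i, the vector B = v - y_i - A lies in two transversal spaces, hence
    vanishes; then so does A. *)
Lemma span_ends y v i : (forall j, throughout F 1 j (y j)) -> v = \sum_j y j ->
  F (-1) i v -> F 1 i v -> y i = v.
Proof.
have [e de ae] := adapted_at locF ge1.
have [f df af] := adapted_at locF le1.
move=> yy vy /ae ev /af fv.
have ey j : supported e (below (p (-1)) j) (y j) by apply/ae/yy.
have fy j : supported f (below (p 1) j) (y j) by apply/af/yy.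
have abv j : below (p 1) i j = (p (-1) i <= p (-1) j).
  rewrite /below rev_p le_eqVlt; congr (_ || _).
  by rewrite (inj_eq inj_p) eq_sym.
have blw j : below (p (-1)) i j = (p (-1) j <= p (-1) i).
  by rewrite /below le_eqVlt (inj_eq inj_p).
pose A := \sum_(j | p (-1) j < p (-1) i) y j.
pose B := \sum_(j | p (-1) i < p (-1) j) y j.
have vAB : v = y i + A + B.
  rewrite vy (bigD1 i) //= -addrA; congr (_ + _).
  rewrite (bigID (fun j => p (-1) j < p (-1) i)) /=; congr (_ + _).
    apply: eq_bigl => j; case: eqVneq => [->|//]; by rewrite ltxx.
  apply: eq_bigl => j; rewrite -leNgt lt_neqAle (inj_eq inj_p) eq_sym.
  by [].
have eA (D : pred I) : (forall j, p (-1) j < p (-1) i -> D j) -> supported e D A.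
  move=> h; apply: supported_sum => j ji; apply: supportedS (ey j) => l.
  by move=> /orP[/eqP->|lj]; apply: h => //; exact: lt_trans lj ji.
have fB (D : pred I) : (forall j, p (-1) i < p (-1) j -> D j) -> supported f D B.
  move=> h; apply: supported_sum => j ij; apply: supportedS (fy j) => l.
  move=> /orP[/eqP->|]; first exact: h.
  by rewrite rev_p => jl; apply: h => //; exact: lt_trans ij jl.
have B0 : B = 0.
  apply: (@transversal e f (fun j => p (-1) j <= p (-1) i)) => //.
  - by move=> j l lj jl; exact: le_trans jl lj.
  - rewrite (_ : B = v - (y i + A)); last by rewrite vAB addrC addKr.
    apply: supportedD.
      by apply: supportedS ev => j; rewrite blw.
    apply/supportedN/supportedD; last by apply: eA => j /ltW.
    by apply: supportedS (ey i) => j; rewrite blw.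
  - by apply: fB => j; rewrite /= -ltNge.
have A0 : A = 0.
  apply: (@transversal e f (fun j => p (-1) j < p (-1) i)) => //.
  - by move=> j l lj jl; exact: le_lt_trans jl lj.
  - exact: eA.
  - rewrite (_ : A = v - y i); last by rewrite vAB B0 addr0 addrC addKr.
    apply: supportedD; first by apply: supportedS fv => j /=; rewrite abv -leNgt.
    by apply/supportedN; apply: supportedS (fy i) => j /=; rewrite abv -leNgt.
by rewrite vAB A0 B0 !addr0.
Qed.

(** The hypotheses see only the two ends; this is what allows two half circles
    with the same ends to be compared. *)
Lemma ends_throughout i v : F (-1) i v -> F 1 i v -> throughout F 1 i v.
Proof.
move=> v0 v1; have [y yy vy] := throughout_span v.
by rewrite -(span_ends yy vy v0 v1).
Qed.

(** The projections onto the intersections of the two flags.  The e_i are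
    injective on these intersections by transversality. *)
Lemma ends_decomposition : exists2 E : I -> 'End(V), decomposition E &
  (forall i v, F (-1) i (E i v) /\ F 1 i (E i v)) /\
  (forall e i, decomposition e -> adapted e (p (-1)) (F (-1)) ->
     (\dim (limg (E i)) <= \dim (limg (e i)))%N).
Proof.
have [f df af] := adapted_at locF le1.
have /choice[y yP] v : exists y : I -> V,
    (forall i, throughout F 1 i (y i)) /\ v = \sum_i y i.
  by have [y] := throughout_span v; exists y.
have yy v i : throughout F 1 i (y v i) := (yP v).1 i.
have ys v : v = \sum_i y v i := (yP v).2.
have thL i a v w :
    throughout F 1 i v -> throughout F 1 i w -> throughout F 1 i (a *: v + w).
  move=> hv hw t t1; have [g dg ag] := adapted_at locF t1.
  have /ag hvg := hv t t1; have /ag hwg := hw t t1.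
  by apply/ag => j nj; rewrite linearP /= hvg // hwg // scaler0 addr0.
(* The decomposition is unique since 0 is at both ends in every step. *)
have uniq v z : (forall i, throughout F 1 i (z i)) -> v = \sum_i z i -> z =1 y v.
  move=> zz vz i.
  have dd j : throughout F 1 j (-1 *: z j + y v j) by exact: thL.
  have d0 : 0 = \sum_j (-1 *: z j + y v j).
    by rewrite big_split /= -scaler_sumr -vz -ys scaleN1r addNr.
  have F0 t : -1 <= t <= 1 -> F t i 0.
    by move=> t1; have [g dg ag] := adapted_at locF t1; apply/ag/supported0.
  have /eqP := span_ends dd d0 (F0 _ ge1) (F0 _ le1).
  by rewrite scaleN1r addrC subr_eq0 => /eqP.
have lin i : linear (fun v => y v i).
  move=> a v w; rewrite -(@uniq _ (fun i => a *: y v i + y w i)) //.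
    by move=> j; exact: thL.
  by rewrite big_split /= -scaler_sumr -!ys.
pose E i : 'End(V) := linfun (HB.pack (fun v => y v i)
  (GRing.isLinear.Build k V V _ (fun v => y v i) (lin i)) : {linear V -> V}).
have EE i v : E i v = y v i by rewrite lfunE.
have dE : decomposition E.
  split=> [i j v|v]; last by under eq_bigr do rewrite EE; rewrite -ys.
  rewrite !EE -(@uniq _ (fun i => if i == j then y v j else 0)) //.
    move=> l; case: eqP => [->//|_] t t1.
    by have [g dg ag] := adapted_at locF t1; apply/ag/supported0.
  by rewrite -big_mkcond big_pred1_eq.
exists E => //; split=> [i v|e i de ae].
  by rewrite EE; split; exact: yy.
apply: leq_dim_limg => u; rewrite EE => e0.
apply: (@transversal e f (fun j => p (-1) j < p (-1) i)) => //.
- by move=> j l lj jl; exact: le_lt_trans jl lj.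
- move=> j; have [->//|ji nji] := eqVneq j i.
  by have /ae := yy u i (-1) ge1; apply; rewrite negb_or ji.
- have /af := yy u i 1 le1; apply: supportedS => j /orP[/eqP->|] /=.
    by rewrite ltxx.
  by rewrite rev_p => /ltW; rewrite -leNgt.
Qed.

End OppositeFlags.

(** The inequalities between dimensions are equalities, because both sides add
    up to the dimension of V; so an inclusion of partial sums is an equality. *)
Lemma decomposition_supported (k : fieldType) (V : vectType k) (I : finType)
    (e E : I -> 'End(V)) (D : pred I) :
  decomposition e -> decomposition E ->
  (forall i, \dim (limg (E i)) <= \dim (limg (e i)))%N ->
  (forall i v, D i -> supported e D (E i v)) ->
  forall v, supported e D v <-> supported E D v.
Proof.
move=> de dE Ee DE v.
suff h : suppv E D = suppv e D.
  by split=> /memv_suppv; [rewrite -h|rewrite h] => /(_ _)/memv_suppv; apply.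
have eqdim i : \dim (limg (E i)) = \dim (limg (e i)).
  have : (\sum_j \dim (limg (E j)) == \sum_j \dim (limg (e j)))%N.
    by rewrite !dim_decomposition.
  rewrite (eq_leqif (leqif_sum (fun j _ => leqif_eq (Ee j)))).
  by move=> /forallP/(_ i)/eqP.
apply/eqP; rewrite eqEdim; apply/andP; split.
  apply/subvP => x /memv_suppv-/(_ dE) /(supported_eq_sum dE) ->.
  by apply: memv_suml => j Dj; apply/memv_suppv => //; exact: DE.
rewrite !dim_suppv //; apply: leq_sum => j _; by rewrite eqdim.
Qed.

(** * Directions, half circles and exponents *)

(** Along a half circle the difference of two heights is a linear form
    evaluated at the points (- t, sqrt (1 - t^2)).  If it vanishes at b it is a
    multiple of the determinant with the point of parameter b, whose sign
    changes only there. *)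
Lemma semicircle_persistent (R : rcfType) (A B s b t : R) : A != 0 ->
  -1 <= s -> s < b -> b <= 1 -> -1 <= t -> t < b ->
  - b * A + Num.sqrt (1 - b ^+ 2) * B = 0 ->
  0 < - s * A + Num.sqrt (1 - s ^+ 2) * B ->
  0 < - t * A + Num.sqrt (1 - t ^+ 2) * B.
Proof.
move=> A0 s1 sb b1 t1 tb gb gs.
have root u : -1 <= u <= 1 -> Num.sqrt (1 - u ^+ 2) ^+ 2 = 1 - u ^+ 2.
  by move=> u1; rewrite sqr_sqrtr //; nra.
have b1' : b < 1.
  rewrite lt_neqAle b1 andbT; apply: contraNneq A0 => b1'.
  move: gb; rewrite b1' expr1n subrr sqrtr0 mul0r addr0 mulN1r => /eqP.
  by rewrite oppr_eq0.
have yb0 : 0 < Num.sqrt (1 - b ^+ 2) by rewrite sqrtr_gt0; nra.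
have rb : Num.sqrt (1 - b ^+ 2) ^+ 2 = 1 - b ^+ 2 by apply: root; lra.
(* This determinant is positive: the angle increases with the parameter. *)
have cross u : -1 <= u -> u < b ->
    0 < b * Num.sqrt (1 - u ^+ 2) - u * Num.sqrt (1 - b ^+ 2).
  move=> u1 ub.
  have ru : Num.sqrt (1 - u ^+ 2) ^+ 2 = 1 - u ^+ 2 by apply: root; lra.
  have yu0 : 0 <= Num.sqrt (1 - u ^+ 2) by exact: sqrtr_ge0.
  move: (Num.sqrt (1 - u ^+ 2)) (Num.sqrt (1 - b ^+ 2)) rb yb0 ru yu0.
  move=> yu yb rb yb0 ru yu0.
  have [b0|b0] := leP b 0.
    have : yu <= yb by rewrite -(@ler_pXn2r _ 2) ?nnegrE ?(ltW yb0) //; nra.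
    by nra.
  have [u0|u0] := leP u 0; last first.
    have : yb <= yu by rewrite -(@ler_pXn2r _ 2) ?nnegrE ?(ltW yb0) //; nra.
    by nra.
  have [u00|u00] := eqVneq u 0; first by move: ru; rewrite u00; nra.
  have : u < 0 by rewrite lt_neqAle u00.
  by nra.
have e u : Num.sqrt (1 - b ^+ 2) * (- u * A + Num.sqrt (1 - u ^+ 2) * B) =
    A * (b * Num.sqrt (1 - u ^+ 2) - u * Num.sqrt (1 - b ^+ 2)).
  have -> : b * Num.sqrt (1 - u ^+ 2) = Num.sqrt (1 - u ^+ 2) * b by ring.
  rewrite -[LHS]subr0 -(mulr0 (Num.sqrt (1 - u ^+ 2))) -gb; ring.
have A_gt0 : 0 < A.
  by rewrite -(pmulr_lgt0 _ (cross s s1 sb)) -e mulr_gt0.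
by rewrite -(pmulr_rgt0 _ yb0) e mulr_gt0 // cross.
Qed.

Lemma generic_slope (R : realFieldType) (I : finType) (A B : I -> R) :
  exists m, forall i, (A i != 0) || (B i != 0) -> A i + m * B i != 0.
Proof.
(* The slope m exceeds all the |A i / B i|, hence is none of the - A i / B i. *)
pose m := 1 + \sum_i `|A i / B i|.
exists m => i; apply: contraTneq => AmB.
have mi : `|A i / B i| < m.
  rewrite /m (bigD1 i) //=.
  have : 0 <= \sum_(j | j != i) `|A j / B j| by apply: sumr_ge0.
  by lra.
have [Bi|Bi] := eqVneq (B i) 0.
  by move: AmB; rewrite Bi mulr0 addr0 => ->; rewrite eqxx.
have m0 : 0 < m by apply: le_lt_trans mi.
have AB : A i / B i = - m.
  by apply: (mulIf Bi); rewrite divfK // mulNr; lra.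
by move: mi; rewrite AB normrN gtr0_norm ?ltxx.
Qed.

Section Arcs.
Variable R : realType.
Implicit Types (x y t s : R) (theta : circle R).

(** Off the unit circle the value 1 is a dummy one. *)
Definition on_circle x y : circle R :=
  if pselect (`|(x +i* y)%C : cplx R| = 1) is left h
  then @set_pt _ [set z : cplx R | `|z| = 1] _ h
  else @set_pt _ [set z : cplx R | `|z| = 1] 1 (normr1 _).

Lemma norm_circle x y : x ^+ 2 + y ^+ 2 = 1 -> `|(x +i* y)%C : cplx R| = 1.
Proof. by move=> xy; rewrite /= normc_def /= xy sqrtr1. Qed.

Lemma on_circleE x y : x ^+ 2 + y ^+ 2 = 1 ->
  set_val (on_circle x y) = (x +i* y)%C.
Proof.
by move=> /norm_circle h; rewrite /on_circle; case: pselect.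
Qed.

Lemma circle_coords theta :
  complex.Re (set_val theta : R[i]) ^+ 2 + complex.Im (set_val theta : R[i]) ^+ 2 = 1.
Proof.
have : `|set_val theta : R[i]| ^+ 2 = 1.
  by have /= := set_valP theta => ->; rewrite expr1n.
by rewrite -add_Re2_Im2 => -[].
Qed.

(** This is (x0 + i y0) (- t + i s sqrt (1 - t^2)), which goes from
    x0 + i y0 at t = -1 to its opposite at t = 1; s = 1 and s = -1 give the two
    halves of the circle. *)
Definition half_circle x0 y0 s t : circle R :=
  on_circle (- t * x0 - s * Num.sqrt (1 - t ^+ 2) * y0)
            (- t * y0 + s * Num.sqrt (1 - t ^+ 2) * x0).

Variables (x0 y0 s : R).
Hypothesis unit0 : x0 ^+ 2 + y0 ^+ 2 = 1.
Hypothesis unit_s : s ^+ 2 = 1.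

Lemma sqr_height t : -1 <= t <= 1 -> Num.sqrt (1 - t ^+ 2) ^+ 2 = 1 - t ^+ 2.
Proof. by move=> t1; rewrite sqr_sqrtr //; nra. Qed.

Lemma half_circleE t : -1 <= t <= 1 -> set_val (half_circle x0 y0 s t) =
  ((- t * x0 - s * Num.sqrt (1 - t ^+ 2) * y0) +i*
   (- t * y0 + s * Num.sqrt (1 - t ^+ 2) * x0))%C.
Proof.
move=> t1; apply: on_circleE; have h := sqr_height t1.
transitivity ((t ^+ 2 + s ^+ 2 * Num.sqrt (1 - t ^+ 2) ^+ 2) * (x0 ^+ 2 + y0 ^+ 2)).
  by ring.
by rewrite unit0 unit_s h; ring.
Qed.

(** The squared distance between the points of parameters t and b is at most
    (t - b)^2 + |t^2 - b^2| <= 4 |t - b|. *)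
Lemma half_circle_continuous (U : opens (circle R)) b : -1 <= b <= 1 ->
  oset U (half_circle x0 y0 s b) ->
  exists2 d, 0 < d & forall t, -1 <= t <= 1 -> b - d < t < b + d ->
    oset U (half_circle x0 y0 s t).
Proof.
move=> b1; have [C oC CU] := osetP U; rewrite -[oset U]CU /= => Cb.
have := open_nbhs_nbhs (conj oC Cb).
rewrite -nbhs_ballE => -[r /= r0 rC].
have r0' : 0 < complex.Re r by move: r0; rewrite ltcE /= => /andP[].
have rE : r = (complex.Re r)%:C%C.
  by move: r0; rewrite ltcE /= => /andP[/eqP]; case: r {rC r0'} => a b' /= ->.
exists (complex.Re r ^+ 2 / 4); first by rewrite divr_gt0 // exprn_gt0.
move=> t t1 tb; apply: rC; rewrite /ball /= !half_circleE //.
rewrite rE normc_def ltcR /=.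
rewrite -[ltRHS]gtr0_norm // -sqrtr_sqr ltr_sqrt ?exprn_gt0 //.
set r' := complex.Re r in r0' tb *.
have ht := sqr_height t1; have hb := sqr_height b1.
have yt0 : 0 <= Num.sqrt (1 - t ^+ 2) by exact: sqrtr_ge0.
have yb0 : 0 <= Num.sqrt (1 - b ^+ 2) by exact: sqrtr_ge0.
move: (Num.sqrt (1 - t ^+ 2)) (Num.sqrt (1 - b ^+ 2)) ht hb yt0 yb0.
move=> yt yb ht hb yt0 yb0.
rewrite [ltLHS](_ : _ = ((t - b) ^+ 2 + s ^+ 2 * (yt - yb) ^+ 2) *
    (x0 ^+ 2 + y0 ^+ 2)); last by ring.
rewrite unit0 unit_s mulr1 mul1r.
have dy : (yt - yb) ^+ 2 <= `|b ^+ 2 - t ^+ 2|.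
  have -> : b ^+ 2 - t ^+ 2 = (yt - yb) * (yt + yb) by rewrite -subr_sqr ht hb; ring.
  rewrite normrM -real_normK ?num_real // expr2 ler_wpM2l //.
  rewrite [X in _ <= X]ger0_norm ?addr_ge0 //.
  by rewrite ler_norml; lra.
have d2 : `|b ^+ 2 - t ^+ 2| <= 2 * `|t - b|.
  rewrite subr_sqr normrM distrC mulrC ler_wpM2r // ler_norml; lra.
have d3 : (t - b) ^+ 2 <= 2 * `|t - b|.
  by rewrite -real_normK ?num_real // expr2 ler_wpM2r // ler_norml; lra.
have d4 : `|t - b| < r' ^+ 2 / 4 by rewrite ltr_norml; lra.
by lra.
Qed.

End Arcs.

(** u + i v is theta divided by x0 + i y0; then t = - u and s is the sign of v. *)
Lemma half_circle_cover (R : realType) (x0 y0 : R) (theta : circle R) :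
  x0 ^+ 2 + y0 ^+ 2 = 1 ->
  exists s t : R, [/\ s = 1 \/ s = -1, -1 <= t <= 1 & theta = half_circle x0 y0 s t].
Proof.
move=> unit0; have xy1 := circle_coords theta.
set x := complex.Re _ in xy1; set y := complex.Im _ in xy1.
pose u := x * x0 + y * y0; pose v := y * x0 - x * y0.
have uv1 : u ^+ 2 + v ^+ 2 = 1.
  transitivity ((x ^+ 2 + y ^+ 2) * (x0 ^+ 2 + y0 ^+ 2)); first by rewrite /u /v; ring.
  by rewrite xy1 unit0 mulr1.
have u1 : -1 <= - u <= 1 by nra.
have [s ss vs] : exists2 s : R, s = 1 \/ s = -1 & v = s * Num.sqrt (1 - (- u) ^+ 2).
  have -> : 1 - (- u) ^+ 2 = v ^+ 2 by rewrite -uv1; ring.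
  rewrite sqrtr_sqr; have [v0|v0] := leP 0 v.
    by exists 1; [left|rewrite ger0_norm ?mul1r].
  by exists (-1); [right|rewrite ltr0_norm // mulN1r opprK].
exists s, (- u); split=> //; apply: val_inj; rewrite [RHS]half_circleE //; last first.
  by case: ss => ->; rewrite ?sqrrN expr1n.
rewrite -vs opprK [LHS](_ : _ = (x +i* y)%C); last first.
  have eta (z : R[i]) : z = (complex.Re z +i* complex.Im z)%C by case: z.
  exact: eta.
congr (_ +i* _)%C.
  by rewrite -[LHS]mulr1 -unit0 /u /v; ring.
by rewrite -[LHS]mulr1 -unit0 /u /v; ring.
Qed.

Lemma opens_bigI (X : topologicalType) (I : finType) (P : I -> Prop)
    (U : I -> opens X) :
  exists W : opens X, forall x, oset W x <-> forall i, P i -> oset (U i) x.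
Proof.
suff [W WP] : exists W : opens X, forall x,
    oset W x <-> forall i, i \in enum I -> P i -> oset (U i) x.
  exists W => x; rewrite WP; split=> h i; first by apply: h; rewrite mem_enum.
  by move=> _; exact: h.
elim: (enum I) => [|j s [W WP]]; first by exists (opensT X).
have [Pj|nPj] := pselect (P j); last first.
  exists W => x; rewrite WP; split=> h i.
    by rewrite in_cons => /orP[/eqP->//|]; exact: h.
  by move=> si; apply: h; rewrite in_cons si orbT.
exists (opensI (U j) W) => x; split=> [[Ux /WP Wx] i|h].
  by rewrite in_cons => /orP[/eqP->//|]; exact: Wx.
split; first by apply: h => //; rewrite in_cons eqxx.
by apply/WP => i si; apply: h; rewrite in_cons si orbT.
Qed.

Lemma le_theta_trans (R : realType) (theta : circle R) (x y z : R[i]) :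
  le_theta theta x y -> le_theta theta y z -> le_theta theta x z.
Proof.
move=> [xy|->//] [yz|<-]; first by left; exact: lt_trans xy yz.
by left.
Qed.

Section CircleSplitting.
Variables (k : fieldType) (V : vectType k) (R : realType) (n : nat).
Variables (c : 'I_n -> R[i]) (F : circle R -> R[i] -> V -> Prop).

Definition dominated (theta : circle R) (xi : R[i]) : pred 'I_n :=
  fun j => `[< le_theta theta (c j) xi >].

Definition splits (e : 'I_n -> 'End(V)) (theta : circle R) :=
  forall xi v, F theta xi v <-> supported e (dominated theta xi) v.

Definition position (theta : circle R) (i : 'I_n) : R :=
  complex.Re (c i * expNi theta).

Hypothesis inj_c : injective c.
Hypothesis locally_splits : forall b : circle R, exists2 U : opens (circle R),
  oset U b & exists2 e, decomposition e & forall theta, oset U theta ->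
    splits e theta.

Lemma dominated_below theta i :
  dominated theta (c i) =1 below (position theta) i.
Proof.
move=> j; rewrite /dominated /below; apply/asboolP/orP => -[h|h].
- by right.
- by left; apply/eqP/inj_c.
- by right; move/eqP: h => ->.
- by left.
Qed.

Lemma splits_adapted e theta : splits e theta ->
  adapted e (position theta) (fun i => F theta (c i)).
Proof.
move=> h i v; rewrite h.
by split; apply: supportedS => j; rewrite dominated_below.
Qed.

Variables (x0 y0 : R).
Hypothesis unit0 : x0 ^+ 2 + y0 ^+ 2 = 1.

(** a + i b is c divided by x0 + i y0. *)
Let a i := complex.Re (c i) * x0 + complex.Im (c i) * y0.
Let b i := complex.Im (c i) * x0 - complex.Re (c i) * y0.
Hypothesis inj_a : injective a.

Lemma position_half_circle s t i : s ^+ 2 = 1 -> -1 <= t <= 1 ->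
  position (half_circle x0 y0 s t) i = - t * a i + s * Num.sqrt (1 - t ^+ 2) * b i.
Proof.
move=> s1 t1; rewrite /position /expNi half_circleE // /a /b.
by case: (c i) => u v /=; ring.
Qed.

Lemma half_circle_end s t : t ^+ 2 = 1 -> half_circle x0 y0 s t = half_circle x0 y0 1 t.
Proof. by move=> t1; rewrite /half_circle t1 subrr sqrtr0 !mulr0 !mul0r. Qed.

Lemma half_circle_locally_split s : s ^+ 2 = 1 ->
  locally_split (fun t => position (half_circle x0 y0 s t))
                (fun t i => F (half_circle x0 y0 s t) (c i)).
Proof.
move=> s1 u u1.
have [U Ub [e de eU]] := locally_splits (half_circle x0 y0 s u).
have [W WP] := opens_bigI (fun ij : 'I_n * 'I_n =>
    position (half_circle x0 y0 s u) ij.1 < position (half_circle x0 y0 s u) ij.2)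
  (fun ij => stokes_open c ij.1 (c ij.2)).
have UWu : oset (opensI U W) (half_circle x0 y0 s u).
  by split=> //; apply/WP => ij; left.
have [d d0 dUW] := half_circle_continuous unit0 s1 u1 UWu.
exists d => //; exists e => // t t1 ut.
have [Ut /WP Wt] := dUW t t1 ut; split; first exact/splits_adapted/eU.
move=> i j ij; have [//|cij] := Wt (i, j) ij.
by have /= ij' := inj_c cij; move: ij; rewrite ij' /= ltxx.
Qed.

Lemma half_circle_persistent s : s ^+ 2 = 1 ->
  persistent (fun t => position (half_circle x0 y0 s t)).
Proof.
move=> s1 i j u r r1 ru u1 ij + + t t1.
rewrite !position_half_circle //; [|lra..] => uij rij.
rewrite -subr_gt0.
have -> : - t * a i + s * Num.sqrt (1 - t ^+ 2) * b i -
    (- t * a j + s * Num.sqrt (1 - t ^+ 2) * b j) =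
  - t * (a i - a j) + Num.sqrt (1 - t ^+ 2) * (s * (b i - b j)) by ring.
apply: (@semicircle_persistent _ _ _ r u) => //; [|lra|lra|..].
- by rewrite subr_eq0 (inj_eq inj_a).
- move: uij => /eqP; rewrite eq_sym -subr_eq0 => /eqP <-; ring.
- by move: rij; rewrite -subr_gt0; congr (_ < _); ring.
Qed.

(** The decomposition built on the half circle s = 1 has its pieces in the steps
    of the other half circle too, as the two have the same ends. *)
Lemma splitting_from_generic : exists2 E, decomposition E &
  forall theta, splits E theta.
Proof.
have sq1 s : s = 1 \/ s = -1 -> s ^+ 2 = 1 :> R.
  by case=> ->; rewrite ?sqrrN expr1n.
have e1 : -1 <= (-1 : R) <= 1 by lra.
have e2 : -1 <= (1 : R) <= 1 by lra.
have pos0 s : s ^+ 2 = 1 -> position (half_circle x0 y0 s (-1)) =1 a.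
  move=> s1 i; rewrite position_half_circle // sqrrN expr1n subrr sqrtr0; ring.
have pos1 s : s ^+ 2 = 1 -> position (half_circle x0 y0 s 1) =1 (fun i => - a i).
  move=> s1 i; rewrite position_half_circle // expr1n subrr sqrtr0; ring.
have inj_pos s : s ^+ 2 = 1 -> injective (position (half_circle x0 y0 s (-1))).
  by move=> s1 i j; rewrite !pos0 //; exact: inj_a.
have rev_pos s : s ^+ 2 = 1 -> forall i j,
    (position (half_circle x0 y0 s 1) i < position (half_circle x0 y0 s 1) j) =
    (position (half_circle x0 y0 s (-1)) j < position (half_circle x0 y0 s (-1)) i).
  by move=> s1 i j; rewrite !pos0 // !pos1 // ltrN2.
have s1 := sq1 1 (or_introl erefl).
have [E dE [EF Edim]] := ends_decomposition (half_circle_locally_split s1)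
  (half_circle_persistent s1) (inj_pos 1 s1) (rev_pos 1 s1).
exists E => // theta xi v.
have [s [t [ss t1 ->]]] := half_circle_cover theta unit0.
have s2 := sq1 s ss.
have [U Ut [e de eU]] := locally_splits (half_circle x0 y0 s t).
rewrite (eU _ Ut).
apply: decomposition_supported => // i; last first.
  move=> w /asboolP ixi.
  have [w0 w1] := EF i w.
  have /(eU _ Ut) : F (half_circle x0 y0 s t) (c i) (E i w).
    apply: (ends_throughout (half_circle_locally_split s2) (half_circle_persistent s2)
              (inj_pos s s2) (rev_pos s s2)) => //.
    - by rewrite half_circle_end // sqrrN expr1n.
    - by rewrite half_circle_end // expr1n.
  apply: supportedS => j /asboolP ji; apply/asboolP.
  exact: le_theta_trans ji ixi.
have [g dg ag] := adapted_at (half_circle_locally_split s2) e1.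
have ae := splits_adapted (eU _ Ut).
have /= -> := sweep_dim (half_circle_locally_split s2) i dg de ag t1 ae.
by apply: Edim => //; move: ag; rewrite half_circle_end // sqrrN expr1n.
Qed.

End CircleSplitting.

Lemma circle_splitting (k : fieldType) (V : vectType k) (R : realType) (n : nat)
    (c : 'I_n -> R[i]) (F : circle R -> R[i] -> V -> Prop) :
  injective c ->
  (forall b : circle R, exists2 U : opens (circle R), oset U b &
     exists2 e, decomposition e & forall theta, oset U theta -> splits c F e theta) ->
  exists2 E, decomposition E & forall theta, splits c F E theta.
Proof.
move=> inj_c loc.
have [m mP] := generic_slope
  (fun ij : 'I_n * 'I_n => complex.Re (c ij.1) - complex.Re (c ij.2))
  (fun ij => complex.Im (c ij.1) - complex.Im (c ij.2)).
pose r := Num.sqrt (1 + m ^+ 2).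
have m2 : 0 < 1 + m ^+ 2 by rewrite ltr_pwDl ?sqr_ge0.
have r0 : r != 0 by rewrite gt_eqF // sqrtr_gt0.
have r2 : r ^+ 2 = 1 + m ^+ 2 by rewrite sqr_sqrtr // ltW.
apply: (@splitting_from_generic _ _ _ _ _ _ inj_c loc r^-1 (m / r)).
  by rewrite expr_div_n exprVn -[X in X + _]mul1r -mulrDl r2 divff // gt_eqF.
move=> i j aij; apply: contrapT => /eqP ij.
have : (complex.Re (c i) - complex.Re (c j) != 0) ||
       (complex.Im (c i) - complex.Im (c j) != 0).
  rewrite -negb_and; apply: contra ij; rewrite !subr_eq0 => /andP[/eqP re /eqP im].
  by apply/eqP/inj_c; move: re im; case: (c i) (c j) => [? ?] [? ?] /= -> ->.
move=> /(mP (i, j)) /=; apply/negP; rewrite negbK; apply/eqP.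
apply: (mulIf (invr_neq0 r0)); rewrite mul0r.
by move/eqP: aij; rewrite -subr_eq0 => /eqP <-; ring.
Qed.

(** * Sections of a constant sheaf *)

Section ConstantSheafValues.
Variables (k : fieldType) (X : topologicalType).

Definition value (V : lmodType k) (U : opens X) (f : const_sheaf X V U)
  (x : X) (Ux : oset U x) : V := lc_val (f : lcfun U V) (set_pt Ux).

Lemma value_ext (V : lmodType k) (U : opens X) (f g : const_sheaf X V U) :
  (forall x (Ux : oset U x), value f Ux = value g Ux) -> f = g.
Proof.
move=> fg; apply: (@val_inj _ _ (lcfun U V)); apply/funext => x /=.
have := fg _ (set_valP x); rewrite /value.
by have -> : set_pt (set_valP x) = x by exact: val_inj.
Qed.

Lemma value_res (V : lmodType k) (U W : opens X) (WU : W `<=` U)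
    (f : const_sheaf X V U) (x : X) (Wx : oset W x) (Ux : oset U x) :
  value (res (const_sheaf X V) WU f) Wx = value f Ux.
Proof. by rewrite /value /=; congr (lc_val _ _); exact: val_inj. Qed.

Lemma value_linear (V : lmodType k) (U : opens X) (x : X) (Ux : oset U x) :
  linear (fun f : const_sheaf X V U => value f Ux).
Proof. by []. Qed.

Lemma value_near (V : lmodType k) (U : opens X) (f : const_sheaf X V U)
    (x : X) (Ux : oset U x) :
  exists2 W : opens X, oset W x &
    forall y, oset W y -> forall Uy : oset U y, value f Uy = value f Ux.
Proof.
have /asboolP/(_ (set_pt Ux))/near_set_type : `[< loc_const (f : lcfun U V) >].
  exact: lc_valP.
rewrite /= => h.
have : nbhs x [set z | forall Uz : oset U z, value f Uz = value f Ux] by exact: h.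
by rewrite nbhsE => -[W [oW Wx] WP]; exists (Opens oW).
Qed.

Lemma loc_const_value (V W : lmodType k) (U : opens X) (h : V -> W)
    (f : const_sheaf X V U) :
  (fun x => h (lc_val (f : lcfun U V) x)) \in
    [pred g : set_type U -> W | `[< loc_const g >] ].
Proof.
apply/asboolP => x; have /asboolP/(_ x) : `[< loc_const (f : lcfun U V) >].
  exact: lc_valP.
by apply: filterS => y /= ->.
Qed.

Definition map_const (V W : lmodType k) (U : opens X) (h : V -> W)
  (f : const_sheaf X V U) : const_sheaf X W U := LCFun (loc_const_value h f).

Lemma value_map_const (V W : lmodType k) (U : opens X) (h : V -> W)
    (f : const_sheaf X V U) (x : X) (Ux : oset U x) :
  value (map_const h f) Ux = h (value f Ux).
Proof. by []. Qed.

Lemma loc_const_cst (V : lmodType k) (U : opens X) (v : V) :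
  (fun=> v) \in [pred g : set_type U -> V | `[< loc_const g >] ].
Proof. by apply/asboolP => x; near=> y. Unshelve. all: by end_near. Qed.

Definition cst_sec (V : lmodType k) (U : opens X) (v : V) : const_sheaf X V U :=
  LCFun (loc_const_cst U v).

End ConstantSheafValues.

Section SheafIso.
Variables (k : fieldType) (X : topologicalType) (U : opens X).
Variables (F G : sheaf k X) (phi : sheaf_iso U F G).

Lemma iso_inj (W : opens X) (WU : W `<=` U) : injective (phi W WU).
Proof. exact: bij_inj (iso_bij phi WU). Qed.

Lemma iso_inverse (W : opens X) (WU : W `<=` U) :
  exists g : {linear G W -> F W}, cancel (phi W WU) g /\ cancel g (phi W WU).
Proof.
have [g fK gK] := iso_bij phi WU.
have gL : linear g := can2_linear fK gK.
by exists (HB.pack g (GRing.isLinear.Build k _ _ _ g gL) : {linear G W -> F W}).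
Qed.

End SheafIso.

(** * From the local gradings to decompositions of V *)

Section LocalDecomposition.
Variables (k : fieldType) (X : topologicalType) (V : vectType k).
Variables (L : sheaf k X) (psi : sheaf_iso (opensT X) L (const_sheaf X V)).

Definition subT (U : opens X) : U `<=` opensT X := fun _ _ => I.

Definition val_at (U : opens X) (s : L U) (x : X) (Ux : oset U x) : V :=
  value (psi U (@subT U) s) Ux.

Lemma val_at_res (U W : opens X) (WU : W `<=` U) (s : L U) (x : X)
  (Wx : oset W x) (Ux : oset U x) : val_at (res L WU s) Wx = val_at s Ux.
Proof. by rewrite /val_at (iso_nat psi (@subT U)); exact: value_res. Qed.

Lemma val_at_ext (U : opens X) (s t : L U) :
  (forall x (Ux : oset U x), val_at s Ux = val_at t Ux) -> s = t.
Proof. by move=> st; apply: (@iso_inj _ _ _ _ _ psi U (@subT U)); exact: value_ext. Qed.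

Lemma val_at0 (U : opens X) (x : X) (Ux : oset U x) : val_at (0 : L U) Ux = 0.
Proof. by rewrite /val_at linear0. Qed.

Lemma val_at_linear (U : opens X) (x : X) (Ux : oset U x) :
  linear (fun s : L U => val_at s Ux).
Proof. by move=> a s t; rewrite /val_at linearP value_linear. Qed.

Lemma val_at_sum (J : finType) (U : opens X) (s : J -> L U) (x : X)
  (Ux : oset U x) : val_at (\sum_j s j) Ux = \sum_j val_at (s j) Ux.
Proof.
apply: (big_morph (fun s => val_at s Ux)) => [t u|]; last exact: val_at0.
by have := val_at_linear Ux 1 t u; rewrite !scale1r.
Qed.

(** The fibre at x of the subsheaf A, seen inside V: the stalk of L at x is
    identified with V through psi. *)
Definition germ_const (A : subsheaf L) (x : X) (v : V) :=
  exists (W : opens X) (s : L W),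
    [/\ oset W x, A W s & forall y (Wy : oset W y), val_at s Wy = v].

(** Membership in a subsheaf is local, and sections of L are locally constant. *)
Lemma subsections_germ (A : subsheaf L) (U : opens X) (s : L U) :
  A U s <-> forall x (Ux : oset U x), germ_const A x (val_at s Ux).
Proof.
split=> [As x Ux|h].
  have [W Wx Wc] := value_near (psi U (@subT U) s) Ux.
  exists (opensI W U), (res L (@subIsetr _ W U : opensI W U `<=` U) s).
  split=> [//||y [Wy Uy]]; first exact: subsec_res.
  by rewrite (val_at_res _ _ _ Uy); exact: Wc.
have /choice[W WP] (x : set_type U) : exists W : opens X,
    exists2 WU : W `<=` U, oset W (set_val x) & A W (res L WU s).
  have [D [t [Dx At tc]]] := h (set_val x) (set_valP x).
  have [C Cx Cc] := value_near (psi U (@subT U) s) (set_valP x).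
  have EU : opensI (opensI C U) D `<=` U by move=> y [[]].
  exists (opensI (opensI C U) D), EU.
    by split=> //; split=> //; exact: (set_valP x).
  have ED : opensI (opensI C U) D `<=` D by move=> y [].
  rewrite (_ : res L EU s = res L ED t); first exact: subsec_res.
  apply: val_at_ext => y Ey; have [[Cy Uy] Dy] := Ey.
  by rewrite (val_at_res _ _ _ Uy) (val_at_res _ _ _ Dy) tc; exact: Cc.
apply: (@subsec_local _ _ _ A U _ W (fun x => let: ex_intro2 WU _ _ := WP x in WU)).
  move=> x Ux; exists (set_pt Ux) => //.
  by have [WU] := WP (set_pt Ux).
by move=> x; case: (WP x).
Qed.

Variables (I : finType) (gr : I -> sheaf k X) (U : opens X).
Variable phi : sheaf_iso U L (dsum gr).

Definition component (W : opens X) (j : I) (t : dsum gr W) : dsum gr W :=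
  fun i => if i == j then (t : dprod _) i else 0.

Lemma component_linear (W : opens X) (j : I) : linear (@component W j).
Proof.
move=> a s t; apply: functional_extensionality_dep => i.
rewrite /component -[RHS]/((a *: (if i == j then (s : dprod _) i else 0) +
   (if i == j then (t : dprod _) i else 0))).
by case: (i == j) => //; rewrite scaler0 addr0.
Qed.


Lemma component_comp (W : opens X) (i j : I) (t : dsum gr W) :
  component i (component j t) = if i == j then component j t else 0.
Proof.
apply: functional_extensionality_dep => l; rewrite /component.
have [<-|ij] := eqVneq i j; first by case: (l == i).
by case: eqVneq => [->|//]; rewrite (negbTE ij).
Qed.

Lemma component_sum (W : opens X) (t : dsum gr W) : \sum_j component j t = t.
Proof.
apply: functional_extensionality_dep => l.
have ev (P : seq I) (f : I -> dsum gr W) :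
    (\sum_(j <- P) f j : dprod _) l = \sum_(j <- P) (f j : dprod _) l.
  by elim: P => [|j P IH]; rewrite ?big_nil // !big_cons -IH.
rewrite ev (bigD1 l) //= /component eqxx big1 ?addr0 // => j jl.
by rewrite eq_sym (negbTE jl).
Qed.

Lemma component_eq0 (W : opens X) (j : I) (t : dsum gr W) :
  component j t = 0 <-> (t : dprod _) j = 0.
Proof.
split=> [/(congr1 (fun f : dprod _ => f j))|tj]; rewrite /component ?eqxx //.
by apply: functional_extensionality_dep => i; case: eqP => [->|].
Qed.

Lemma component_res (W W' : opens X) (WW : W' `<=` W) (j : I) (t : dsum gr W) :
  res (dsum gr) WW (component j t) = component j (res (dsum gr) WW t).
Proof.
apply: functional_extensionality_dep => i.
rewrite /component -[LHS]/(res (gr i) WW (component j t i)) /component.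
by case: (i == j) => //; rewrite linear0.
Qed.

(** The projection of L onto the part of L that phi maps to the j-th summand.  It
    is through these endomorphisms of the locally constant sheaf L, rather than
    through the summands, that the decomposition of V is obtained. *)
Definition proj (W : opens X) (WU : W `<=` U) (j : I) (s : L W) : L W :=
  sval (cid (iso_inverse phi WU)) (component j (phi W WU s)).

Lemma projE (W : opens X) (WU : W `<=` U) (j : I) (s : L W) :
  phi W WU (proj WU j s) = component j (phi W WU s).
Proof. by rewrite /proj; case: cid => g [] /= _ ->. Qed.

Lemma proj_linear (W : opens X) (WU : W `<=` U) (j : I) : linear (proj WU j).
Proof.
by move=> a s t; apply: (@iso_inj _ _ _ _ _ phi W WU);
  rewrite linearP !projE linearP component_linear.
Qed.

Lemma proj_res (W W' : opens X) (WU : W `<=` U) (WU' : W' `<=` U)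
    (WW : W' `<=` W) (j : I) (s : L W) :
  res L WW (proj WU j s) = proj WU' j (res L WW s).
Proof.
apply: (@iso_inj _ _ _ _ _ phi W' WU').
by rewrite projE !(iso_nat phi WU WU') projE component_res.
Qed.

Lemma proj_proj (W : opens X) (WU : W `<=` U) (i j : I) (s : L W) :
  proj WU i (proj WU j s) = if i == j then proj WU j s else 0.
Proof.
apply: (@iso_inj _ _ _ _ _ phi W WU); rewrite !projE component_comp.
by case: eqP; rewrite ?projE ?linear0.
Qed.

Lemma proj_sum (W : opens X) (WU : W `<=` U) (s : L W) : \sum_j proj WU j s = s.
Proof.
apply: (@iso_inj _ _ _ _ _ phi W WU); rewrite linear_sum.
under eq_bigr do rewrite projE; exact: component_sum.
Qed.

Lemma proj_eq0 (W : opens X) (WU : W `<=` U) (j : I) (s : L W) :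
  proj WU j s = 0 <-> (phi W WU s : dprod _) j = 0.
Proof.
rewrite -component_eq0 -projE; split=> [->|]; first by rewrite linear0.
by move=> h; apply: (@iso_inj _ _ _ _ _ phi W WU); rewrite h linear0.
Qed.

(** e_j v is the value at b of the j-th projection of the constant section v.
    This projection is locally constant, so it is constant near b, on a
    neighbourhood that can be chosen uniformly in v since V has a finite
    basis. *)
Lemma local_decomposition (b : X) : oset U b ->
  exists2 U' : opens X, oset U' b & exists2 e : I -> 'End(V), decomposition e &
    forall (W : opens X) (WU : W `<=` U) (s : L W) (x : X) (v : V),
      W `<=` U' -> oset W x -> (forall y (Wy : oset W y), val_at s Wy = v) ->
      forall j, (phi W WU s : dprod _) j = 0 <-> e j v = 0.
Proof.
move=> Ub.
have [g [_ gK]] := iso_inverse psi (@subT U).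
pose h v := g (cst_sec U v).
have hE v y (Uy : oset U y) : val_at (h v) Uy = v by rewrite /val_at gK.
have UU : U `<=` U by [].
pose G j y (Uy : oset U y) v := val_at (proj UU j (h v)) Uy.
have GL j y (Uy : oset U y) : linear (G j y Uy).
  move=> a v w; rewrite /G /val_at.
  have -> : h (a *: v + w) = a *: h v + h w.
    by rewrite /h -linearP; congr (g _); exact: value_ext.
  by rewrite proj_linear linearP value_linear.
pose e j y (Uy : oset U y) : 'End(V) := linfun (HB.pack (G j y Uy)
  (GRing.isLinear.Build k V V _ (G j y Uy) (GL j y Uy)) : {linear V -> V}).
have eE j y (Uy : oset U y) v : e j y Uy v = val_at (proj UU j (h v)) Uy.
  by rewrite lfunE.
pose B := vbasis {:V}.
have /choice[C CP] (jm : I * 'I_(\dim {:V})) : exists C : opens X, oset C b /\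
    forall y, oset C y -> forall Uy, e jm.1 y Uy B`_jm.2 = e jm.1 b Ub B`_jm.2.
  have [C Cb Cc] := value_near (psi U (@subT U) (proj UU jm.1 (h B`_jm.2))) Ub.
  by exists C; split=> // y Cy Uy; rewrite !eE; exact: Cc.
have [U1 U1P] := opens_bigI (fun _ => True) C.
have econst j y (Uy : oset U y) v : oset U1 y -> e j y Uy v = e j b Ub v.
  move=> /U1P U1y; rewrite (coord_vbasis (memvf v)) !linear_sum /=.
  apply: eq_bigr => m _; rewrite !linearZ /=; congr (_ *: _).
  by apply: (CP (j, m)).2; exact: U1y.
have key (W : opens X) (WU : W `<=` U) (s : L W) v : W `<=` U1 ->
    (forall y (Wy : oset W y), val_at s Wy = v) ->
    forall j y (Wy : oset W y), val_at (proj WU j s) Wy = e j b Ub v.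
  move=> WU1 sv j y Wy.
  have -> : s = res L WU (h v).
    by apply: val_at_ext => z Wz; rewrite (val_at_res _ _ _ (WU _ Wz)) hE.
  rewrite -(proj_res UU) (val_at_res _ _ _ (WU _ Wy)) -eE econst //.
  exact: WU1.
have U1b : oset U1 b by apply/U1P => jm _; exact: (CP jm).1.
pose W0 := opensI U U1.
have W0U : W0 `<=` U by exact: subIsetl.
have W01 : W0 `<=` U1 by exact: subIsetr.
have W0b : oset W0 b by [].
have r0 v y (Wy : oset W0 y) : val_at (res L W0U (h v)) Wy = v.
  by rewrite (val_at_res _ _ _ (W0U _ Wy)) hE.
exists U1 => //; exists (fun j => e j b Ub).
  split=> [i j v|v].
    rewrite -(key W0 W0U (proj W0U j (res L W0U (h v))) _ W01 _ i b W0b).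
      rewrite proj_proj; case: eqP => _; first exact: key.
      by rewrite val_at0.
    by move=> y Wy; exact: key.
  rewrite -[RHS](r0 v b W0b) -[in RHS](proj_sum W0U (res L W0U (h v))).
  by rewrite val_at_sum; apply: eq_bigr => j _; rewrite (key W0 W0U _ v).
move=> W WU s x v WU1 Wx sv j; rewrite -proj_eq0; split=> [pj|ev].
  by rewrite -(key W WU s v WU1 sv j x Wx) pj val_at0.
by apply: val_at_ext => y Wy; rewrite val_at0 (key W WU s v).
Qed.

End LocalDecomposition.

Lemma dsum_ext_by_zeroP (k : fieldType) (X : topologicalType) (I : finType)
    (gr : I -> sheaf k X) (Z : I -> opens X) (U : opens X) (t : dsum gr U) :
  dsum_sub (fun i => ext_by_zero (gr i) (Z i)) U t <->
  forall i, supp ((t : dprod _) i) `<=` Z i.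
Proof. by []. Qed.

(** A section of the j-th summand coming from a constant one is zero or nowhere
    zero on small open sets; so it is supported in Z_j near x if and only if it
    is zero or x is in Z_j. *)
Lemma germ_const_graded (k : fieldType) (X : topologicalType) (V : vectType k)
    (L : sheaf k X) (psi : sheaf_iso (opensT X) L (const_sheaf X V))
    (I : finType) (gr : I -> sheaf k X) (U : opens X)
    (phi : sheaf_iso U L (dsum gr)) (b : X) : oset U b ->
  exists2 U' : opens X, oset U' b & exists2 e : I -> 'End(V), decomposition e &
    forall (A : subsheaf L) (Z : I -> opens X),
      carries phi A (dsum_sub (fun i => ext_by_zero (gr i) (Z i))) ->
      forall x v, oset U' x ->
        germ_const psi A x v <-> forall j, ~ oset (Z j) x -> e j v = 0.
Proof.
move=> Ub; have [U1 U1b [e de eP]] := local_decomposition psi phi Ub.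
exists (opensI U U1) => //; exists e => // A Z cAZ x v [Ux U1x].
split=> [[W [s [Wx As sv]]] j nZx|h].
  pose W1 := opensI W (opensI U U1).
  have W1U : W1 `<=` U by move=> y [_ []].
  have W1W : W1 `<=` W by move=> y [].
  pose s1 := res L W1W s.
  have : (phi W1 W1U @` A W1) (phi W1 W1U s1) by exists s1 => //; exact: subsec_res.
  rewrite cAZ => /dsum_ext_by_zeroP/(_ j) supps.
  have W1x : oset W1 x by [].
  have /germ0P-/(_ W1x)[W2 [W21 [W2x s20]]] :
      germ x ((phi W1 W1U s1 : dprod _) j) = germ x (0 : gr j W1).
    by apply: contrapT => ns; apply/nZx/supps.
  have W2U := subset_trans W21 W1U.
  apply/(eP W2 W2U (res L W21 s1) x v) => //.
  - by move=> y /W21[_ []].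
  - move=> y W2y; rewrite (val_at_res _ _ _ _ (W21 _ W2y)).
    by rewrite (val_at_res _ _ _ _ (W1W _ (W21 _ W2y))).
  - by rewrite (iso_nat phi W1U W2U W21).
have [W WP] := opens_bigI (fun j => oset (Z j) x) Z.
pose W1 := opensI W (opensI U U1).
have W1U : W1 `<=` U by move=> y [_ []].
have W1x : oset W1 x by split=> //; apply/WP.
have [g [_ gK]] := iso_inverse psi (@subT _ W1).
pose s := g (cst_sec W1 v).
have sv y (Wy : oset W1 y) : val_at psi s Wy = v by rewrite /val_at gK.
exists W1, s; split=> //.
have : dsum_sub (fun i => ext_by_zero (gr i) (Z i)) W1 (phi W1 W1U s).
  apply/dsum_ext_by_zeroP => j y [W1y nsy].
  have [/WP Wy _] := W1y.
  have [Zx|nZx] := pselect (oset (Z j) x); first exact: Wy.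
  exfalso; apply: nsy; congr (germ y _).
  apply/(eP W1 W1U s x v) => //; last exact: h.
  by move=> z [_ []].
by rewrite -cAZ => -[t At /iso_inj <-].
Qed.

(** * The trivial Stokes structure of a decomposition *)

Section ConstantGraded.
Variables (k : fieldType) (X : topologicalType) (V : vectType k).
Variables (L : sheaf k X) (psi : sheaf_iso (opensT X) L (const_sheaf X V)).
Variables (I : finType) (E : I -> 'End(V)).
Hypothesis dE : decomposition E.

Definition const_gr (i : I) : sheaf k X := const_sheaf X (subvs_of (limg (E i))).

Lemma const_gr_constant i : constant_local_system (const_gr i).
Proof.
exists (subvs_of (limg (E i))); constructor.
exact: (@SheafIso _ _ _ _ _ (fun W _ => idfun)).
Qed.

Definition to_gr (U : opens X) (UT : U `<=` opensT X) (s : L U) :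
    dsum const_gr U :=
  fun i => map_const (fun v => vsproj (limg (E i)) (E i v)) (psi U UT s).

Lemma value_to_gr_vsproj (U : opens X) (UT : U `<=` opensT X) (s : L U) i x
    (Ux : oset U x) :
  value (to_gr UT s i) Ux = vsproj (limg (E i)) (E i (value (psi U UT s) Ux)).
Proof. by []. Qed.

Lemma to_gr_linear (U : opens X) (UT : U `<=` opensT X) : linear (to_gr UT).
Proof.
move=> a s t; apply: functional_extensionality_dep => i.
apply: value_ext => x Ux.
rewrite -[RHS]/(a *: value (to_gr UT s i) Ux + value (to_gr UT t i) Ux).
by rewrite !value_to_gr_vsproj linearP value_linear !linearP.
Qed.

HB.instance Definition _ (U : opens X) (UT : U `<=` opensT X) :=
  GRing.isLinear.Build k (L U) (dsum const_gr U) _ (to_gr UT) (to_gr_linear UT).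

Lemma value_to_gr (U : opens X) (UT : U `<=` opensT X) (s : L U) i x
    (Ux : oset U x) :
  vsval (value (to_gr UT s i) Ux) = E i (value (psi U UT s) Ux).
Proof. by rewrite value_to_gr_vsproj vsprojK // memv_img // memvf. Qed.

Lemma to_gr_nat (U W : opens X) (UT : U `<=` opensT X) (WT : W `<=` opensT X)
    (WU : W `<=` U) (s : L U) :
  to_gr WT (res L WU s) = res (dsum const_gr) WU (to_gr UT s).
Proof.
apply: functional_extensionality_dep => i; apply: value_ext => x Wx.
rewrite -[res (dsum _) WU _ i]/(res (const_gr i) WU (to_gr UT s i)).
rewrite (value_res _ _ _ (WU _ Wx)) !value_to_gr_vsproj (iso_nat psi UT).
by rewrite (value_res _ _ _ (WU _ Wx)).
Qed.

Lemma to_gr_bij (U : opens X) (UT : U `<=` opensT X) : bijective (to_gr UT).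
Proof.
have [g [gK Kg]] := iso_inverse psi UT.
pose from (t : dsum const_gr U) : L U := g
  (\sum_i map_const (fun w => vsval w) ((t : dprod _) i)).
have value_sum (f : I -> const_sheaf X V U) x (Ux : oset U x) :
    value (\sum_i f i) Ux = \sum_i value (f i) Ux.
  by apply: (big_morph (fun s : const_sheaf X V U => value s Ux)).
exists from => [s|t].
  rewrite -[RHS]gK; congr (g _); apply: value_ext => x Ux.
  rewrite value_sum -[RHS](dE.2); apply: eq_bigr => i _.
  by rewrite value_map_const value_to_gr.
apply: functional_extensionality_dep => i; apply: value_ext => x Ux.
apply: val_inj; rewrite [LHS]value_to_gr Kg value_sum linear_sum (bigD1 i) //=.
have fixE j : E j (vsval (value ((t : dprod _) j) Ux)) =
    vsval (value ((t : dprod _) j) Ux).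
  have /memv_imgP[u _ ->] := subvsP (value ((t : dprod _) j) Ux).
  exact: decomp_id.
rewrite big1 ?addr0 ?value_map_const ?fixE // => j ji.
by rewrite -[vsval _](fixE j) decomp_neq // eq_sym.
Qed.

Definition gr_iso : sheaf_iso (opensT X) L (dsum const_gr) :=
  @SheafIso _ _ _ _ _ (fun U UT => to_gr UT) to_gr_nat to_gr_bij.

Lemma gr_iso_carries (A : subsheaf L) (Z : I -> opens X) :
  (forall x v, germ_const psi A x v <-> forall j, ~ oset (Z j) x -> E j v = 0) ->
  carries gr_iso A (dsum_sub (fun i => ext_by_zero (const_gr i) (Z i))).
Proof.
move=> AZ U UT; have eUT : UT = @subT X U by exact: Prop_irrelevance.
suff h (s : L U) : A U s <->
    dsum_sub (fun i => ext_by_zero (const_gr i) (Z i)) U (gr_iso U UT s).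
  apply/seteqP; split=> [_ [s As <-]|t Zt]; first exact/h.
  have [f fK Kf] := iso_bij gr_iso UT.
  by exists (f t) => //; apply/h; rewrite Kf.
rewrite (subsections_germ psi); split=> [sA|/dsum_ext_by_zeroP sZ x Ux].
  apply/dsum_ext_by_zeroP => j x [Ux nsx].
  apply: contrapT => nZx; apply: nsx; apply/germ0P => //.
  have [W Wx Wc] := value_near (to_gr UT s j) Ux.
  have WU : opensI W U `<=` U by move=> y [].
  exists (opensI W U), WU; split=> //; apply: value_ext => y Wy.
  have [Wy' Uy] := Wy; rewrite (value_res _ _ _ Uy) (Wc y Wy' Uy).
  apply: val_inj; rewrite [LHS]value_to_gr eUT.
  by have /AZ/(_ j nZx) := sA x Ux.
apply/AZ => j nZx.
have nsx : ~ supp ((gr_iso U UT s : dprod _) j) x by move/sZ.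
have /germ0P-/(_ Ux)[W [WU [Wx s0]]] :
    germ x ((gr_iso U UT s : dprod _) j) = germ x (0 : const_gr j U).
  by apply: contrapT => ne; apply: nsx.
rewrite -[LHS](value_to_gr (@subT X U) s j Ux) -eUT.
by rewrite -[value _ _](value_res WU _ Wx) s0.
Qed.

End ConstantGraded.

Theorem corollary6p29 (k : fieldType) (R : realType) (n : nat)
    (c : 'I_n -> complex R) (S : stokes_structure k c) :
  constant_local_system (stokes_sheaf S) -> trivial_stokes S.
Proof.
move=> [V [psi]]; have [gr [_ loc]] := stokes_graded S.
have [b|E dE EP] := @circle_splitting k V R n c
  (fun theta xi => germ_const psi (stokes_le S xi) theta) (exponents_inj S).
  have [U [Ub [phi phiA]]] := loc b.
  have [U1 U1b [e de eP]] := germ_const_graded psi phi Ub.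
  exists U1 => //; exists e => // theta U1t xi v.
  rewrite (eP _ _ (phiA xi) theta v U1t).
  by split=> h j nj; apply: h; exact/asboolPn.
exists (const_gr (circle R) E); split; first exact: const_gr_constant.
exists (gr_iso psi dE) => xi; apply: gr_iso_carries => theta v.
rewrite (EP theta xi v).
by split=> h j nj; apply: h; exact/asboolPn.
Qed.
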